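(* For any $z\in\mathbb{D}$, we have $$\inf_{\mathcal{R}}\ \mathbb{E}_{\mathbb{P}_{K_{\mathbb{D}}}}\Big[\sup_{f\in A^2(\mathbb{D}):\|f\|\le1}\Big|\frac{g_X^{\mathcal{R}}(z;f)}{g^{\mathcal{R}}_{\mathbb{P}_{K_{\mathbb{D}}}}}-f(z)\Big|^2\Big]\ge\frac{1}{128}\quad\text{with } g^{\mathcal{R}}_{\mathbb{P}_{K_{\mathbb{D}}}}:=\mathbb{E}_{\mathbb{P}_{K_{\mathbb{D}}}}[g_X^{\mathcal{R}}(z)],$$ where the infimum is taken over all non-negative bounded compactly supported radial functions $\mathcal{R}$ on $\mathbb{D}$ that are not Lebesgue-almost everywhere zero.
   Context: $\mathbb{D}$ is the open unit disk in $\mathbb{C}$, $dA$ is Lebesgue measure on $\mathbb{D}$ normalized so that $A(\mathbb{D})=1$, and $K_{\mathbb{D}}(z,w)=(1-z\bar w)^{-2}$ is the Bergman kernel. $A^2(\mathbb{D})$ is the space of holomorphic $f:\mathbb{D}\to\mathbb{C}$ with $\|f\|^2=\int_{\mathbb{D}}|f|^2dA<\infty$. $\mathrm{Conf}(\mathbb{D})$ is the space of (locally finite) configurations $X$ on $\mathbb{D}$, and $\mathbb{P}_{K_{\mathbb{D}}}$ is the determinantal point process induced by $K_{\mathbb{D}}$: the unique simple point process (Borel probability measure on $\mathrm{Conf}(\mathbb{D})$) whose $n$-th correlation function with respect to $dA$ is $\det(K_{\mathbb{D}}(x_i,x_j))_{1\le i,j\le n}$ for all $n\ge1$. For $\mathcal{R}:\mathbb{D}\to\mathbb{R}_+$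 bounded, measurable, compactly supported in $\mathbb{D}$ and radial, set $g_X^{\mathcal{R}}(z;f)=\sum_{x\in X}\mathcal{R}(\varphi_z(x))f(x)$ and $g_X^{\mathcal{R}}(z)=\sum_{x\in X}\mathcal{R}(\varphi_z(x))$, where $\varphi_z(x)=\frac{x-z}{1-\bar z x}$. The expectation $\mathbb{E}_{\mathbb{P}_{K_{\mathbb{D}}}}[g_X^{\mathcal{R}}(z)]$ does not depend on $z$. *)

(* Defs.v *)
From HB Require Import structures.
From mathcomp Require Import all_boot all_order all_algebra.
From mathcomp Require Import all_classical all_reals all_analysis.
From mathcomp Require Import measurable_realfun random_variable complex.
From mathcomp Require Import lra.

Set Implicit Arguments.
Unset Strict Implicit.
Unset Printing Implicit Defensive.

Import Order.TTheory GRing.Theory Num.Theory.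
Import numFieldNormedType.Exports.
Import Normc.

Local Open Scope classical_set_scope.
Local Open Scope ring_scope.
Local Open Scope complex_scope.

(* The library puts a topology on [R[i]^o] only; this transports it to [R[i]]. *)
#[non_forgetful_inheritance]
HB.instance Definition _ (R : realType) := NormedModule.copy R[i] R[i]^o.

Definition to_plane (R : realType) (z : R[i]) : R * R :=
  (complex.Re z, complex.Im z).

Definition of_plane (R : realType) (p : R * R) : R[i] := p.1 +i* p.2.

(* The measurable sets of [R[i]] are the preimages under [to_plane] of the
   members of the product of the Borel sigma-algebras of [R], that is, the
   Borel sets. *)
HB.instance Definition _ (R : realType) :=
  Measurable.copy R[i] (g_sigma_algebra_preimageType (@to_plane R)).

Lemma measurable_of_plane (R : realType) : measurable_fun setT (@of_plane R).
Proof.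
move=> _ _ [B mB <-]; rewrite !setTI -comp_preimage.
by rewrite (_ : @to_plane R \o @of_plane R = id) //; apply/funext => -[].
Qed.

Section Disc.
Context {R : realType}.
Local Notation C := R[i].

Definition plane_measure : set C -> \bar R :=
  pushforward (lebesgue_measure \x lebesgue_measure)%E (@of_plane R).

Lemma plane_measure0 : plane_measure set0 = 0%E.
Proof. by rewrite /plane_measure /pushforward preimage_set0 measure0. Qed.

Lemma plane_measure_ge0 A : (0 <= plane_measure A)%E.
Proof. by rewrite /plane_measure /pushforward measure_ge0. Qed.

Lemma plane_measure_sigma_additive : semi_sigma_additive plane_measure.
Proof.
exact: (@measure_semi_sigma_additive _ _ _
  (measure_function_pushforward__canonical__measure_function_Measure
     (lebesgue_measure \x lebesgue_measure)%E (@measurable_of_plane R))).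
Qed.

HB.instance Definition _ := isMeasure.Build _ _ _ plane_measure
  plane_measure0 plane_measure_ge0 plane_measure_sigma_additive.

Definition disc : set C := [set z | `|z| < 1].

Lemma disc_mass_inv_ge0 : 0 <= (fine (plane_measure disc))^-1.
Proof. by rewrite invr_ge0 fine_ge0. Qed.

(* Lebesgue measure normalized by [area disc = 1]; it lives on the whole plane,
   and integrals against it are taken over [disc]. *)
Definition area : {measure set C -> \bar R} :=
  mscale (NngNum disc_mass_inv_ge0) plane_measure.

Definition relatively_compact (B : set C) :=
  exists K : set C, [/\ compact K, K `<=` disc & B `<=` K].

Definition bergman_kernel (z w : C) : C := (1 - z * conjc w) ^- 2.

(* A function on the disc is represented by a function on [C]; only its values
   on [disc] matter. *)
Definition holomorphic_on_disc (f : C -> C) :=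
  forall z, disc z -> derivable f z 1.

Definition L2norm_sqr (f : C -> C) : \bar R :=
  (\int[area]_(z in disc) (normc (f z) ^+ 2)%:E)%E.

Definition bergman_space : set (C -> C) :=
  [set f | holomorphic_on_disc f /\ (L2norm_sqr f < +oo)%E].

Definition bergman_norm (f : C -> C) : R := Num.sqrt (fine (L2norm_sqr f)).

Definition mobius (z x : C) : C := (x - z) / (1 - conjc z * x).

End Disc.
Arguments disc R : clear implicits.
Arguments area R : clear implicits.

Lemma measurable_disc (R : realType) : measurable (disc R).
Proof.
exists [set p : R * R | p.1 ^+ 2 + p.2 ^+ 2 < 1]; last first.
  rewrite setTI; apply/seteqP; split => -[x y] /=.
    move=> h; rewrite /disc /= normc_def /= ltcR -sqrtr1 ltr_sqrt//.
  rewrite /disc /= normc_def /= ltcR -[X in _ < X -> _]sqrtr1 ltr_sqrt//.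
have h : measurable_fun setT (fun p : R * R => p.1 ^+ 2 + p.2 ^+ 2).
  apply: measurable_funD; apply: measurable_funX; [exact: measurable_fst|exact: measurable_snd].
rewrite -[mkset _]setTI (_ : mkset _ = (fun p : R * R => p.1 ^+ 2 + p.2 ^+ 2) @^-1` `]-oo, 1[%classic).
  by apply: h.
by apply/seteqP; split => p /=; rewrite in_itv.
Qed.

Lemma plane_measure_square (R : realType) (a : R) : 0 <= a ->
  plane_measure (@of_plane R @` (`[(- a), a] `*` `[(- a), a])) = ((a + a) * (a + a))%:E.
Proof.
move=> a0; rewrite /plane_measure /pushforward.
rewrite (_ : _ @^-1` _ = `[(- a), a] `*` `[(- a), a]); last first.
  apply/seteqP; split => [[x y] /= [[x' y'] h] [<- <-] //|[x y] h].
  by exists (x, y).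
rewrite product_measure1E//= lebesgue_measure_itv /= !lte_fin.
have [h|h] := ltP (- a) a; first by rewrite -EFinB opprK EFinM.
have -> : a = 0 by lra.
by rewrite addr0 mul0r mule0.
Qed.

Lemma area_disc (R : realType) : area R (disc R) = 1%E.
Proof.
have fin : plane_measure (disc R) = (fine (plane_measure (disc R)))%:E.
  rewrite fineK// ge0_fin_numE//.
  apply: (@le_lt_trans _ _ (((1 + 1) * (1 + 1))%:E)); last by rewrite ltry.
  rewrite -plane_measure_square//; apply: le_measure; rewrite ?inE; [exact: measurable_disc| | ].
    exists (`[(-1), 1] `*` `[(-1), 1]); first exact: measurableX.
    rewrite setTI; apply/seteqP; split => [[x y] h|_ [[x y] h <-]//].
    by exists (x, y).
  move=> [x y]; rewrite /disc /= normc_def /= ltcR -[X in _ < X -> _]sqrtr1 ltr_sqrt// => h.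
  exists (x, y) => //=; rewrite !in_itv /=; split; nra.
change (((fine (plane_measure (disc R)))^-1)%:E * plane_measure (disc R) = 1)%E.
rewrite {2}fin -EFinM mulVf//.
suff : (0 < plane_measure (disc R))%E.
  by rewrite {1}fin lte_fin => /gt_eqF ->.
apply: (@lt_le_trans _ _ (((2^-1 + 2^-1 : R) * (2^-1 + 2^-1))%R%:E)); first by rewrite lte_fin; lra.
clear fin; rewrite -plane_measure_square; last lra.
apply: le_measure; rewrite ?inE; [|exact: measurable_disc|].
  exists (`[(-(2^-1)), 2^-1] `*` `[(-(2^-1)), 2^-1]); first exact: measurableX.
  rewrite setTI; apply/seteqP; split => [[x y] h|_ [[x y] h <-]//].
  by exists (x, y).
move=> _ [[x y] /= [] + + <-]; rewrite !in_itv /= => hx hy.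
rewrite /disc /= normc_def /= ltcR -[ltRHS]sqrtr1 ltr_sqrt//; nra.
Qed.

(* A configuration is given by the multiplicity of each point. *)
Record configuration (R : realType) := Configuration {
  mult :> R[i] -> nat ;
  mult_disc : forall x, mult x != 0%N -> disc R x ;
  mult_locally_finite : forall K : set R[i], compact K -> K `<=` disc R ->
    finite_set [set x | K x /\ mult x != 0%N] }.

Section Configurations.
Context {R : realType}.
Local Notation C := R[i].

HB.instance Definition _ := gen_eqMixin (configuration R).
HB.instance Definition _ := gen_choiceMixin (configuration R).

Fact empty_conf_disc (x : C) : 0%N != 0%N -> disc R x. Proof. by []. Qed.

Fact empty_conf_locally_finite (K : set C) : compact K -> K `<=` disc R ->
  finite_set [set x | K x /\ 0%N != 0%N].
Proof.
by move=> _ _; rewrite (_ : mkset _ = set0) //; apply/seteqP; split => x // [].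
Qed.

HB.instance Definition _ := isPointed.Build (configuration R)
  (Configuration empty_conf_disc empty_conf_locally_finite).

(* Sum of [F] over the points of [X], counted with multiplicity. The library
   makes it [0] when infinitely many terms are nonzero; there are finitely many
   as soon as [F] vanishes off a relatively compact subset of the disc. *)
Definition conf_sum (V : nmodType) (X : configuration R) (F : C -> V) : V :=
  \sum_(x \in disc R) F x *+ X x.

Definition conf_count (X : configuration R) (B : set C) : nat :=
  conf_sum X (fun x => (x \in B) : nat).

Definition counting_events : set (set (configuration R)) :=
  [set E | exists (B : set C) (k : nat),
    [/\ measurable B, relatively_compact B & E = [set X | conf_count X B = k]]].

End Configurations.
Arguments counting_events R : clear implicits.

(* The Borel sigma-algebra of the vague topology is the one generated by the
   numbers of points in relatively compact Borel sets. *)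
Definition Conf (R : realType) := g_sigma_algebraType (counting_events R).

Section PointProcess.
Context {R : realType}.
Local Notation C := R[i].

Definition simple_process (P : probability (Conf R) R) :=
  \forall X \ae P, forall x : C, ((X : configuration R) x <= 1)%N.

(* Multiple points are told apart by labels, so that the [n]-tuples below are
   those of distinct points of [X] even when [X] is not simple. *)
Definition labelled_points (X : configuration R) : set (C * nat) :=
  [set p | (p.2 < X p.1)%N].

Definition distinct_sum (n : nat) (X : configuration R)
    (phi : n.-tuple C -> \bar R) : \bar R :=
  \esum_(s in [set s : n.-tuple (C * nat) |
                 uniq s /\ forall p, p \in s -> labelled_points X p])
     phi (map_tuple fst s).

(* Integral over [disc^n] against the [n]-th power of [area], for nonnegative
   measurable integrands (Tonelli). *)
Fixpoint disc_integral (n : nat) : (n.-tuple C -> \bar R) -> \bar R :=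
  match n with
  | 0%N => fun F => F [tuple]
  | m.+1 => fun F =>
      (\int[area R]_(x in disc R) disc_integral (fun t => F (cons_tuple x t)))%E
  end.

Definition correlation_function (P : probability (Conf R) R) (n : nat)
    (rho : n.-tuple C -> R) :=
  forall phi : n.-tuple C -> \bar R,
    measurable_fun [set: n.-tuple C] phi -> (forall t, (0 <= phi t)%E) ->
    (\int[P]_X distinct_sum X phi = disc_integral (fun t => phi t * (rho t)%:E))%E.

(* For a Hermitian kernel the determinant is real, and taking the real part only
   changes its type. *)
Definition determinantal_process (P : probability (Conf R) R)
    (K : C -> C -> C) :=
  simple_process P /\
  forall n : nat, (0 < n)%N ->
    correlation_function P (fun t : n.-tuple C =>
      complex.Re (\det (\matrix_(i < n, j < n) K (tnth t i) (tnth t j)))).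

Definition g_stat (Rf : C -> R) (z : C) (X : configuration R) : R :=
  conf_sum X (fun x => Rf (mobius z x)).

Definition g_stat_fun (Rf : C -> R) (z : C) (f : C -> C)
    (X : configuration R) : C :=
  conf_sum X (fun x => (Rf (mobius z x))%:C * f x).

Definition g_mean (P : probability (Conf R) R) (Rf : C -> R) (z : C) : R :=
  fine 'E_P[fun X : Conf R => g_stat Rf z X].

Record admissible_weight (Rf : C -> R) : Prop := AdmissibleWeight {
  weight_measurable : measurable_fun setT Rf ;
  weight_ge0 : forall x, 0 <= Rf x ;
  weight_bounded : exists M, forall x, Rf x <= M ;
  weight_compact_support : relatively_compact [set x | Rf x != 0] ;
  weight_radial : forall x y, `|x| = `|y| -> Rf x = Rf y ;
  weight_not_ae0 : ~ (\forall x \ae area R, Rf x = 0) }.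

End PointProcess.

(* Main.v *)
From HB Require Import structures.
Require Import Defs.
From mathcomp Require Import all_boot all_order all_algebra.
From mathcomp Require Import all_classical all_reals all_analysis.
From mathcomp Require Import measurable_realfun random_variable complex.
From mathcomp Require Import lra ring.

(** The supremum over the unit ball of [A^2] is a squared dual norm, so it is at
    least the sum of the squared errors on finitely many orthonormal functions
    [e_k(x) = sqrt (k + 1) x^k]. Write [w] for the weight divided by the mean of its
    linear statistic. The error on [e_k] is the linear statistic of [w e_k] minus the
    constant [e_k(z)], so its second moment is at least a variance, and it suffices
    to bound from below the sum of these variances. (If the mean is [0], so is the
    quotient by it, and the constant function [1] has error [1].)

    For a determinantal process the variances are explicit. With [K] the Bergman
    kernel and [K_N] its truncation they sum to
<<
      \int w(x)^2 K_N(x,x) K(x,x) dA(x)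
        - \int\int w(x) w(y) Re K_N(x,y) |K(x,y)|^2 dA(x) dA(y).
>>
    The weight lives in a disc of radius [r < 1], on which [K_N] is uniformly close
    to [K]. Put [h(x) = w(x) K(x,x)], which has integral one. The first term is then
    nearly [\int h^2]. The second one is nearly at most [\int\int h(x) h(y) kappa(x,y)]
    with [kappa(x,y) = |K(x,y)|^3 / (K(x,x) K(y,y))], and
<<
      \int kappa(x,y) dA(y) <= 1/2
>>
    for every [x], by expanding [(1 - x conj(y))^(-3)] in powers of [conj(y)]. By the
    Schur test the second term is nearly at most half of [\int h^2]. Hence the sum of
    the variances is at least almost [1/2 \int h^2 >= 1/2 (\int h)^2 = 1/2]; the
    truncation leaves [39/100], well above [1/128].

    The steps are carried by [momentE], the orthogonality of the monomials, which
    comes from the divergence theorem on the disc; [schur_bound], the Schur test;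
    [second_moment_ge], the second moments of linear statistics, which rests on
    [distinct_sum2] and on the measurability of the statistics; [spectral_bound], the
    sum over the basis; and [sup_recon_error_ge], the duality. *)

Set Implicit Arguments.
Unset Strict Implicit.
Unset Printing Implicit Defensive.

Import Order.TTheory GRing.Theory Num.Theory.
Import numFieldNormedType.Exports.

Local Open Scope classical_set_scope.
Local Open Scope ring_scope.
Local Open Scope complex_scope.

(** * Bounded measurable functions and complex coordinates *)

Section BoundedMeasurable.
Context {R : realType}.

(** The domain [D] bounds [f] only: measurability is asked everywhere, so that
    the integrals over [D] and over products stay free of restrictions. *)
Definition bmeas d (T : measurableType d) (D : set T) (f : T -> R) :=
  measurable_fun setT f /\ exists M, forall x, D x -> `|f x| <= M.

Section Generic.
Context d (T : measurableType d) (D : set T).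

Lemma bmeas_cst (c : R) : bmeas D (fun=> c).
Proof. by split; [exact: measurable_cst|exists `|c|]. Qed.

Lemma bmeasD f g : bmeas D f -> bmeas D g -> bmeas D (fun x => f x + g x).
Proof.
move=> [mf [M hM]] [mg [N hN]]; split; first exact: measurable_funD.
by exists (M + N) => x Dx; rewrite (le_trans (ler_normD _ _))// lerD ?hM ?hN.
Qed.

Lemma bmeasN f : bmeas D f -> bmeas D (fun x => - f x).
Proof.
move=> [mf [M hM]]; split; first exact: measurableT_comp.
by exists M => x Dx; rewrite normrN hM.
Qed.

Lemma bmeasB f g : bmeas D f -> bmeas D g -> bmeas D (fun x => f x - g x).
Proof. by move=> bf bg; apply: bmeasD => //; exact: bmeasN. Qed.

Lemma bmeasM f g : bmeas D f -> bmeas D g -> bmeas D (fun x => f x * g x).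
Proof.
move=> [mf [M hM]] [mg [N hN]]; split; first exact: measurable_funM.
by exists (M * N) => x Dx; rewrite normrM ler_pM ?hM ?hN.
Qed.

Lemma bmeasX f n : bmeas D f -> bmeas D (fun x => f x ^+ n).
Proof.
move=> bf; elim: n => [|n ih]; first by under eq_fun do rewrite expr0; exact: bmeas_cst.
by under eq_fun do rewrite exprS; exact: bmeasM.
Qed.

Lemma bmeas_sum (I : Type) (r : seq I) (f : I -> T -> R) :
  (forall i, bmeas D (f i)) -> bmeas D (fun x => \sum_(i <- r) f i x).
Proof.
move=> bf; elim: r => [|i r ih].
  by under eq_fun do rewrite big_nil; exact: bmeas_cst.
by under eq_fun do rewrite big_cons; exact: bmeasD.
Qed.

Lemma bmeas_ext f g : f =1 g -> bmeas D f -> bmeas D g.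
Proof. by move=> /funext ->. Qed.

Variables (m : {measure set T -> \bar R}) (mD : measurable D).
Hypothesis mDfin : (m D < +oo)%E.

Lemma bmeas_integrable f : bmeas D f -> m.-integrable D (EFin \o f).
Proof.
move=> [mf [M hM]]; apply: measurable_bounded_integrable => //.
  exact: measurable_funTS.
by exists M; split; [exact: num_real|move=> N MN x Dx; exact: le_trans (hM x Dx) (ltW MN)].
Qed.

Lemma bmeas_RintegralD f g : bmeas D f -> bmeas D g ->
  \int[m]_(x in D) (f x + g x) = \int[m]_(x in D) f x + \int[m]_(x in D) g x.
Proof. by move=> bf bg; rewrite RintegralD//; exact: bmeas_integrable. Qed.

Lemma bmeas_RintegralB f g : bmeas D f -> bmeas D g ->
  \int[m]_(x in D) (f x - g x) = \int[m]_(x in D) f x - \int[m]_(x in D) g x.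
Proof. by move=> bf bg; rewrite RintegralB//; exact: bmeas_integrable. Qed.

Lemma bmeas_RintegralZl f c : bmeas D f ->
  \int[m]_(x in D) (c * f x) = c * \int[m]_(x in D) f x.
Proof. by move=> bf; rewrite RintegralZl//; exact: bmeas_integrable. Qed.

Lemma bmeas_Rintegral_sum (I : Type) (r : seq I) (f : I -> T -> R) :
  (forall i, bmeas D (f i)) ->
  \int[m]_(x in D) (\sum_(i <- r) f i x) = \sum_(i <- r) \int[m]_(x in D) f i x.
Proof.
move=> bf; elim: r => [|i r ih].
  rewrite big_nil; under eq_Rintegral do rewrite big_nil.
  by rewrite Rintegral_cst// mul0r.
rewrite big_cons -ih -bmeas_RintegralD//; last exact: bmeas_sum.
by apply: eq_Rintegral => x _; rewrite big_cons.
Qed.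

Lemma bmeas_le_Rintegral f g : bmeas D f -> bmeas D g -> (forall x, D x -> f x <= g x) ->
  \int[m]_(x in D) f x <= \int[m]_(x in D) g x.
Proof. by move=> bf bg fg; apply: le_Rintegral => //; exact: bmeas_integrable. Qed.

Lemma bmeas_RintegralE f : bmeas D f ->
  (\int[m]_(x in D) (f x)%:E = (\int[m]_(x in D) f x)%:E)%E.
Proof.
move=> bf; rewrite /Rintegral fineK//; apply: integrable_fin_num => //.
exact: bmeas_integrable.
Qed.

End Generic.
End BoundedMeasurable.

Section Plane.
Context {R : realType}.
Local Notation C := R[i].
Local Notation Re := (@complex.Re R).
Local Notation Im := (@complex.Im R).

Lemma ReM (x y : C) : Re (x * y) = Re x * Re y - Im x * Im y.
Proof. by case: x y => [a b] [c d]. Qed.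

Lemma ImM (x y : C) : Im (x * y) = Re x * Im y + Im x * Re y.
Proof. by case: x y => [a b] [c d] /=; rewrite addrC. Qed.

Lemma ReD (x y : C) : Re (x + y) = Re x + Re y.
Proof. by case: x y => [a b] [c d]. Qed.

Lemma ImD (x y : C) : Im (x + y) = Im x + Im y.
Proof. by case: x y => [a b] [c d]. Qed.

Lemma ReN (x : C) : Re (- x) = - Re x. Proof. by case: x. Qed.
Lemma ImN (x : C) : Im (- x) = - Im x. Proof. by case: x. Qed.

Lemma Re_sum (I : Type) (r : seq I) (P : pred I) (F : I -> C) :
  Re (\sum_(i <- r | P i) F i) = \sum_(i <- r | P i) Re (F i).
Proof. by rewrite (big_morph Re ReD (erefl _)). Qed.

Lemma Im_sum (I : Type) (r : seq I) (P : pred I) (F : I -> C) :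
  Im (\sum_(i <- r | P i) F i) = \sum_(i <- r | P i) Im (F i).
Proof. by rewrite (big_morph Im ImD (erefl _)). Qed.

Lemma sqr_normcE (z : C) : Normc.normc z ^+ 2 = Re z ^+ 2 + Im z ^+ 2.
Proof. by case: z => a b /=; rewrite sqr_sqrtr// addr_ge0 ?sqr_ge0. Qed.

Lemma discE (z : C) : disc R z <-> Normc.normc z < 1.
Proof. by rewrite /disc /= -ltcR. Qed.

Lemma measurable_to_plane : measurable_fun setT (@to_plane R).
Proof. by move=> _ B mB; exists B. Qed.

Lemma measurable_Re : measurable_fun setT Re.
Proof. exact: (measurableT_comp measurable_fst measurable_to_plane). Qed.

Lemma measurable_Im : measurable_fun setT Im.
Proof. exact: (measurableT_comp measurable_snd measurable_to_plane). Qed.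

(** The sigma-algebra of the plane is pulled back from the product of two Borel
    lines, so measurability is tested on the two coordinates. *)
Lemma measurable_complexP d (T : measurableType d) (f : T -> C) :
  measurable_fun setT (Re \o f) -> measurable_fun setT (Im \o f) ->
  measurable_fun setT f.
Proof.
move=> mr mi _ _ [B mB <-]; rewrite !setTI -comp_preimage.
rewrite -[X in measurable X]setTI.
have : measurable_fun setT (fun t => (Re (f t), Im (f t))).
  by apply/measurable_fun_pair.
by apply.
Qed.

(** A complex polynomial on the real line differentiates like its formal
    derivative; the variable is real, so multiplying by it commutes with taking
    real parts and no imaginary part enters the induction. *)
Lemma is_derive_Re_horner (p : {poly C}) (x : R) :
  is_derive x 1 (fun t : R => Re p.[t%:C]) (Re (p^`()).[x%:C]).
Proof.
elim/poly_ind: p => [|p c ih].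
  rewrite deriv0 horner0; under eq_fun do rewrite horner0.
  exact: is_derive_cst.
rewrite derivD derivM derivX derivC addr0 mulr1 !hornerE.
under eq_fun do rewrite !hornerE ReD ReM /= mulr0 subr0.
rewrite ReD ReM /= mulr0 subr0.
apply: is_derive_eq.
by rewrite /= addr0 addrC mulrC /GRing.scale /= mulr1.
Qed.

End Plane.

(** * The divergence theorem on the disc *)

Section Divergence.
Context {R : realType}.
Local Notation C := R[i].
Local Notation Re := (@complex.Re R).
Local Notation Im := (@complex.Im R).
Local Notation leb := (@lebesgue_measure R).

(** The divergence theorem on a chord: [dg] is the derivative of [g], and [g]
    vanishes at both ends of the chord at height [y]. *)
Lemma slice_integral0 (g dg : R -> R) (y : R) :
  (forall x : R, is_derive x 1 g (dg x)) -> continuous dg ->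
  (forall x : R, x ^+ 2 + y ^+ 2 = 1 -> g x = 0) ->
  (\int[leb]_(x in [set x | x ^+ 2 + y ^+ 2 < 1]%R) (dg x)%:E = 0)%E.
Proof.
move=> gdg cdg g0.
have [y1|y1] := leP 1 (y ^+ 2).
  rewrite (_ : mkset _ = set0) ?integral_set0//.
  apply/seteqP; split => x //= h.
  have := sqr_ge0 x; lra.
pose s := Num.sqrt (1 - y ^+ 2).
have s0 : 0 < s by rewrite sqrtr_gt0; lra.
have s2 : s ^+ 2 = 1 - y ^+ 2 by rewrite sqr_sqrtr//; lra.
rewrite (_ : mkset _ = [set` `]-s, s[]); last first.
  apply/seteqP; split => x /=; rewrite in_itv /= -ltr_norml.
    move=> h; rewrite -(ltr_pXn2r (n := 2)) ?nnegrE ?(ltW s0)// real_normK ?num_real// s2; lra.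
  rewrite -(ltr_pXn2r (n := 2)) ?nnegrE ?(ltW s0)// real_normK ?num_real// s2; lra.
rewrite -(@integral_itv_bndoo _ _ _ _ true false); last first.
  apply/measurable_EFinP; apply: measurable_funTS; exact: continuous_measurable_fun.
have cg : continuous g.
  by move=> x; apply/differentiable_continuous/derivable1_diffP; case: (gdg x).
rewrite (@continuous_FTC2 _ dg g).
- by rewrite !g0 ?subee// ?sqrrN s2; lra.
- lra.
- exact: continuous_subspaceT.
- split; [by move=> x _; case: (gdg x)| |].
    by apply: cvg_at_right_filter; exact: cg.
  by apply: cvg_at_left_filter; exact: cg.
- by move=> x _; rewrite derive1E; apply: derive_val.
Qed.

Lemma of_plane_disc :
  @of_plane R @^-1` disc R = [set p : R * R | p.1 ^+ 2 + p.2 ^+ 2 < 1].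
Proof.
apply/seteqP; split => -[x y]; rewrite /disc /= normc_def /= ltcR => h.
  by move: h; rewrite -[ltRHS]sqrtr1 ltr_sqrt.
by rewrite -[ltRHS]sqrtr1 ltr_sqrt.
Qed.

Lemma measurable_disc_plane :
  measurable [set p : R * R | p.1 ^+ 2 + p.2 ^+ 2 < 1].
Proof.
have := @measurable_of_plane R measurableT _ (measurable_disc R).
by rewrite setTI of_plane_disc.
Qed.

Lemma plane_measure_disc_fin : (plane_measure (disc R) < +oo)%E.
Proof.
apply: (@le_lt_trans _ _ (((1 + 1) * (1 + 1))%:E)); last by rewrite ltry.
rewrite -plane_measure_square//; apply: le_measure; rewrite ?inE; [exact: measurable_disc| | ].
  exists (`[(-1), 1] `*` `[(-1), 1]); first exact: measurableX.
  rewrite setTI; apply/seteqP; split => [[x y] h|_ [[x y] h <-]//].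
  by exists (x, y).
move=> [x y]; rewrite /disc /= normc_def /= ltcR -[X in _ < X -> _]sqrtr1 ltr_sqrt// => h.
exists (x, y) => //=; rewrite !in_itv /=; split; nra.
Qed.

(** Fubini in either order. Stating it once for both directions is what lets the
    derivatives along the two axes be combined later into the operator dbar. *)
Lemma chord_integral0 (F : C -> R) : bmeas (disc R) F ->
  (forall y, \int[leb]_(x in [set x | x ^+ 2 + y ^+ 2 < 1]%R) (F (x +i* y))%:E = 0)%E \/
  (forall x, \int[leb]_(y in [set y | y ^+ 2 + x ^+ 2 < 1]%R) (F (x +i* y))%:E = 0)%E ->
  \int[area R]_(z in disc R) F z = 0.
Proof.
move=> bF chord.
have [mF [M hM]] := bF.
have mE : measurable_fun (disc R) (EFin \o F) by apply/measurable_EFinP;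
  exact: measurable_funTS.
suff plane0 : (\int[plane_measure]_(z in disc R) (F z)%:E = 0)%E.
  rewrite /Rintegral integralE !ge0_integral_mscale//; last first.
    exact: measurable_funepos.
  - exact: measurable_disc.
  - exact: measurable_funeneg.
  - exact: measurable_disc.
  rewrite -muleBr//.
    by rewrite -integralE plane0 mule0.
  have pF : (@plane_measure R).-integrable (disc R) (EFin \o F).
    apply: bmeas_integrable => //; [exact: measurable_disc|exact: plane_measure_disc_fin].
  apply: fin_num_adde_defl.
  rewrite fin_numN.
  have /integral_fune_fin_num := integrable_funeneg (measurable_disc R) pF.
  by apply => //; exact: measurable_disc.
pose D := [set p : R * R | p.1 ^+ 2 + p.2 ^+ 2 < 1].
have DE : @of_plane R @^-1` disc R = D := of_plane_disc.
have finD : ((leb \x leb)%E D < +oo)%E.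
  by rewrite -DE; exact: plane_measure_disc_fin.
have iF : (leb \x leb)%E.-integrable D (EFin \o (F \o @of_plane R)).
  apply: bmeas_integrable => //; first exact: measurable_disc_plane.
  split; first by apply: measurableT_comp => //; exact: measurable_of_plane.
  by exists M => p; rewrite -DE => /hM.
have -> : (\int[plane_measure]_(z in disc R) (F z)%:E =
    \int[leb \x leb]_(p in D) (F (of_plane p))%:E)%E.
  rewrite -DE /plane_measure integral_pushforward//.
  - exact: measurable_of_plane.
  - exact/measurable_EFinP.
  - by rewrite DE.
  - exact: measurable_disc.
have iFD : (leb \x leb)%E.-integrable setT ((EFin \o (F \o @of_plane R)) \_ D).
  by apply/integrable_restrict => //=; [exact: measurable_disc_plane|rewrite setTI].
rewrite integral_mkcond.
case: chord => chord.
  rewrite -integral21_prod_meas1//; apply: integral0_eq => y _.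
  rewrite /= /fubini_G -[RHS](chord y) [in RHS]integral_mkcond.
  apply: eq_integral => x _; rewrite /patch.
  by congr (if _ then _ else _); apply/idP/idP; rewrite !inE.
rewrite -integral12_prod_meas1//; apply: integral0_eq => x _.
rewrite /= /fubini_F -[RHS](chord x) [in RHS]integral_mkcond.
apply: eq_integral => y _; rewrite /patch.
by congr (if _ then _ else _); apply/idP/idP; rewrite !inE/= addrC.
Qed.

End Divergence.

(** * Moments of the area measure *)

Section Moments.
Context {R : realType}.
Local Notation C := R[i].
Local Notation Re := (@complex.Re R).
Local Notation Im := (@complex.Im R).

Section cbmeas.
Context d (T : measurableType d).

Definition cbmeas (D : set T) (F : T -> C) :=
  bmeas D (fun z => Re (F z)) /\ bmeas D (fun z => Im (F z)).

Lemma cbmeas_cst D (c : C) : cbmeas D (fun=> c).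
Proof. by split; exact: bmeas_cst. Qed.

Lemma cbmeasD D F G : cbmeas D F -> cbmeas D G -> cbmeas D (fun z => F z + G z).
Proof.
move=> [rF iF] [rG iG]; split.
  by under eq_fun do rewrite ReD; exact: bmeasD.
by under eq_fun do rewrite ImD; exact: bmeasD.
Qed.

Lemma cbmeasN D F : cbmeas D F -> cbmeas D (fun z => - F z).
Proof.
move=> [rF iF]; split.
  by under eq_fun do rewrite ReN; exact: bmeasN.
by under eq_fun do rewrite ImN; exact: bmeasN.
Qed.

Lemma cbmeasB D F G : cbmeas D F -> cbmeas D G -> cbmeas D (fun z => F z - G z).
Proof. by move=> hF hG; apply: cbmeasD => //; exact: cbmeasN. Qed.

Lemma cbmeasM D F G : cbmeas D F -> cbmeas D G -> cbmeas D (fun z => F z * G z).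
Proof.
move=> [rF iF] [rG iG]; split.
  by under eq_fun do rewrite ReM; apply: bmeasB; exact: bmeasM.
by under eq_fun do rewrite ImM; apply: bmeasD; exact: bmeasM.
Qed.

Lemma cbmeasX D F n : cbmeas D F -> cbmeas D (fun z => F z ^+ n).
Proof.
move=> hF; elim: n => [|n ih].
  by under eq_fun do rewrite expr0; exact: cbmeas_cst.
by under eq_fun do rewrite exprS; exact: cbmeasM.
Qed.

Lemma cbmeas_conj D F : cbmeas D F -> cbmeas D (fun z => conjc (F z)).
Proof.
move=> [rF iF]; split.
  by apply: bmeas_ext rF => z /=; case: (F z).
by apply: bmeas_ext (bmeasN iF) => z /=; case: (F z).
Qed.

Lemma cbmeas_sum D (I : Type) (r : seq I) (F : I -> T -> C) :
  (forall i, cbmeas D (F i)) -> cbmeas D (fun z => \sum_(i <- r) F i z).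
Proof.
move=> bf; elim: r => [|i r ih].
  by under eq_fun do rewrite big_nil; exact: cbmeas_cst.
by under eq_fun do rewrite big_cons; exact: cbmeasD.
Qed.

End cbmeas.

Lemma normc_ge0 (z : C) : 0 <= Normc.normc z.
Proof. by case: z => x y; exact: sqrtr_ge0. Qed.

Lemma cbmeas_id : cbmeas (disc R) id.
Proof.
have h (z : C) : disc R z -> `|Re z| <= 1 /\ `|Im z| <= 1.
  move=> /discE z1; have : Normc.normc z ^+ 2 <= 1.
    by rewrite exprn_ile1 ?normc_ge0 ?ltW.
  rewrite sqr_normcE => {}z1; rewrite -!(@ler_sqr _ _ 1) ?nnegrE// !real_normK ?num_real//
    expr1n.
  have := sqr_ge0 (Re z); have := sqr_ge0 (Im z); split; lra.
by split; split; [exact: measurable_Re| |exact: measurable_Im|]; exists 1 => z /h[].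
Qed.

Definition mono a b (z : C) : C := z ^+ a * (conjc z) ^+ b.

Lemma cbmeas_mono a b : cbmeas (disc R) (mono a b).
Proof. exact: cbmeasM (cbmeasX a cbmeas_id) (cbmeasX b (cbmeas_conj cbmeas_id)). Qed.

(** The formal derivatives in [z] and in [conjc z] of
    [mono a b z * (1 - z * conjc z)], a monomial cut off so as to vanish on the
    unit circle. *)
Definition d_mono a b (z : C) : C :=
  a%:R * mono a.-1 b z - a.+1%:R * mono a b.+1 z.
Definition dbar_mono a b (z : C) : C :=
  b%:R * mono a b.-1 z - b.+1%:R * mono a.+1 b z.

Lemma cbmeas_d_mono a b : cbmeas (disc R) (d_mono a b).
Proof. by apply: cbmeasB; (apply: cbmeasM; [exact: cbmeas_cst|exact: cbmeas_mono]). Qed.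

Lemma cbmeas_dbar_mono a b : cbmeas (disc R) (dbar_mono a b).
Proof. by apply: cbmeasB; (apply: cbmeasM; [exact: cbmeas_cst|exact: cbmeas_mono]). Qed.

(** The same function on a line, where [z] and [conjc z] become two affine
    polynomials [p] and [q] in the real parameter. *)
Definition line_poly (K : comNzRingType) a b (p q : {poly K}) : {poly K} :=
  p ^+ a * q ^+ b * (1 - p * q).

Lemma line_poly_deriv (K : comNzRingType) a b (p q : {poly K}) (z w dp dq x : K) :
  p.[x] = z -> q.[x] = w -> p^`() = dp%:P -> q^`() = dq%:P ->
  (line_poly a b p q)^`().[x] =
    dp * (a%:R * (z ^+ a.-1 * w ^+ b) - a.+1%:R * (z ^+ a * w ^+ b.+1)) +
    dq * (b%:R * (z ^+ a * w ^+ b.-1) - b.+1%:R * (z ^+ a.+1 * w ^+ b)).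
Proof.
move=> hp hq hdp hdq.
have e (n : nat) (x0 : K) : n%:R * x0 ^+ n.-1 * x0 = n%:R * x0 ^+ n.
  by case: n => [|n]; rewrite ?mul0r// -mulrA -exprSr.
have := e a z; have := e b w.
rewrite /line_poly !(derivM, derivB, derivX, derivC, deriv_exp) hdp hdq.
rewrite !(hornerE, horner_exp, hornerMn) hp hq -[_ * _ *+ a]mulr_natr -[_ * _ *+ b]mulr_natr
  (exprS z a) (exprS w b) -(natr1 a) -(natr1 b).
move: (z ^+ a) (w ^+ b) (z ^+ a.-1) (w ^+ b.-1) a%:R b%:R => Z W U V na nb hb ha.
apply/eqP; rewrite -subr_eq0; apply/eqP.
transitivity (dp * W * w * (na * Z - na * U * z) + dq * Z * z * (nb * W - nb * V * w)).
  rewrite /=; ring.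
by rewrite ha hb !subrr !mulr0 addr0.
Qed.

(** On a horizontal line [z] has derivative [1], on a vertical one ['i]: these are
    the derivatives of the cut-off monomial along the two axes, and they integrate
    to zero along each chord because it vanishes at the ends. *)
Lemma axis_derivative_integral0 a b c (t : C) : t = 1 \/ t = 'i%C -> 
  \int[area R]_(z in disc R) Re (c * (t * d_mono a b z + conjc t * dbar_mono a b z)) = 0.
Proof.
have bF : bmeas (disc R) (fun z => Re (c * (t * d_mono a b z + conjc t * dbar_mono a b z))).
  have [] // : cbmeas (disc R) (fun z => (c * (t * d_mono a b z + conjc t * dbar_mono a b z))).
  apply: cbmeasM; first exact: cbmeas_cst.
  by apply: cbmeasD; (apply: cbmeasM; [exact: cbmeas_cst|]);
    [exact: cbmeas_d_mono|exact: cbmeas_dbar_mono].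
have key (y : R) (p q : {poly C}) (l : R -> C) : 
     (forall x : R, p.[x%:C] = l x) -> (forall x : R, q.[x%:C] = conjc (l x)) ->
     (forall x : R, x ^+ 2 + y ^+ 2 = 1 -> l x * conjc (l x) = 1) ->
     p^`() = t%:P -> q^`() = (conjc t)%:P ->
     (\int[lebesgue_measure]_(x in [set x | x ^+ 2 + y ^+ 2 < 1]%R) 
        (Re (c * (t * d_mono a b (l x) + conjc t * dbar_mono a b (l x))))%:E = 0)%E.
  move=> hp hq hl hdp hdq.
  pose P := c *: line_poly a b p q.
  have dP (x : R) : P^`().[x%:C] = c * (t * d_mono a b (l x) + conjc t * dbar_mono a b (l x)).
    by rewrite derivZ hornerZ (line_poly_deriv a b (hp x) (hq x) hdp hdq).
  apply: (@slice_integral0 _ (fun x : R => Re P.[x%:C])).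
  - by move=> x; rewrite -dP; exact: is_derive_Re_horner.
  - move=> x; under eq_fun do rewrite -dP.
    apply/differentiable_continuous/derivable1_diffP.
    by case: (is_derive_Re_horner (P^`()) x).
  - move=> x h; rewrite hornerZ !(hornerE, horner_exp) hp hq hl//.
    by rewrite /= subrr mulr0.
move=> tE; apply: chord_integral0 => //.
case: tE => tE; [left => y|right => y].
  apply: (@key y ('X + (0 +i* y)%:P) ('X - (0 +i* y)%:P) (fun x => x +i* y)).
  - by move=> x; rewrite !hornerE; simpc.
  - by move=> x; rewrite !hornerE; simpc.
  - by move=> x h; apply/eqP; rewrite eq_complex /=; apply/andP; split; apply/eqP;
    rewrite -?h; ring.
  - by rewrite derivD derivX derivC addr0 tE.
  - by rewrite derivB derivX derivC subr0 tE conjc1.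
apply: (@key y ('i *: 'X + (y%:C)%:P) ((-'i) *: 'X + (y%:C)%:P) (fun x => y +i* x)).
- by move=> x; rewrite !hornerE; simpc.
- by move=> x; rewrite !hornerE; simpc.
- by move=> x h; apply/eqP; rewrite eq_complex /=; apply/andP; split; apply/eqP; rewrite -?h;
  ring.
- by rewrite derivD derivZ derivX derivC addr0 tE alg_polyC.
- by rewrite derivD derivZ derivX derivC addr0 tE alg_polyC; congr (_ %:P); simpc.
Qed.

Lemma bmeas_Re_mono c a b : bmeas (disc R) (fun z => Re (c * mono a b z)).
Proof.
have [] // : cbmeas (disc R) (fun z => c * mono a b z).
by apply: cbmeasM; [exact: cbmeas_cst|exact: cbmeas_mono].
Qed.

Lemma area_disc_fin : (area R (disc R) < +oo)%E.
Proof. by rewrite area_disc ltry. Qed.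

Definition moment (c : C) a b : R := \int[area R]_(z in disc R) Re (c * mono a b z).

(** [dbar] is half of the derivative along the first axis plus ['i] times half of
    the derivative along the second one. *)
Lemma dbar_integral0 a b c :
  \int[area R]_(z in disc R) Re (c * dbar_mono a b z) = 0.
Proof.
have bF (t s k : C) : bmeas (disc R) (fun z => Re (k * (t * d_mono a b z + s * dbar_mono a b
  z))).
  have [] // : cbmeas (disc R) (fun z => (k * (t * d_mono a b z + s * dbar_mono a b z))).
  apply: cbmeasM; first exact: cbmeas_cst.
  by apply: cbmeasD; (apply: cbmeasM; [exact: cbmeas_cst|]);
    [exact: cbmeas_d_mono|exact: cbmeas_dbar_mono].
have h1 := @axis_derivative_integral0 a b (c / 2%:R) 1 (or_introl (erefl _)).
have h2 := @axis_derivative_integral0 a b (c / 2%:R * 'i%C) 'i%C (or_intror (erefl _)).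
rewrite -[RHS]addr0 -[X in X + _]h1 -[X in _ + X]h2.
rewrite -bmeas_RintegralD//; [|exact: measurable_disc|exact: area_disc_fin].
apply: eq_Rintegral => z _; rewrite -ReD; congr (Re _).
have gen (K : comNzRingType) (k i D E : K) : i * i = -1 ->
    (k + k) * E = k * (1 * D + 1 * E) + (k * i) * (i * D + (- i) * E).
  move=> ii; transitivity (k * D + k * E + (i * i) * (k * D - k * E)); last by ring.
  by rewrite ii; ring.
have ii : 'i%C * 'i%C = -1 :> C by rewrite -expr2 sqr_i.
rewrite conjc1; have -> : conjc 'i%C = - 'i%C :> C by simpc.
by rewrite -(gen _ _ _ _ _ ii) -splitr.
Qed.

Lemma Re_natM n (w : C) : Re (n%:R * w) = n%:R * Re w.
Proof.
by elim: n => [|n ih]; [rewrite !mul0r|rewrite -!natr1 !mulrDl !mul1r ReD ih].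
Qed.

(** The vanishing of the integral of [dbar_mono] read as a recurrence: both exponents
    drop by one, which reduces every moment to a pure power or to the total mass. *)
Lemma momentSS a b c : b.+2%:R * moment c a.+1 b.+1 = b.+1%:R * moment c a b.
Proof.
apply/eqP; rewrite eq_sym -subr_eq0; apply/eqP.
rewrite -(dbar_integral0 a b.+1 c) -!bmeas_RintegralZl ?area_disc//;
  do ?[exact: measurable_disc|exact: bmeas_Re_mono|by rewrite ltry].
rewrite -bmeas_RintegralB ?area_disc//;
  do ?[exact: measurable_disc|apply: bmeasM; [exact: bmeas_cst|exact: bmeas_Re_mono]|by
    rewrite ltry].
apply: eq_Rintegral => z _; rewrite /dbar_mono /= mulrBr ReD ReN.
have e n (w : C) : Re (c * (n%:R * w)) = n%:R * Re (c * w).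
  by rewrite mulrCA Re_natM.
by rewrite !e.
Qed.

Lemma moment_a0 a c : moment c a.+1 0 = 0.
Proof.
apply/eqP; rewrite -oppr_eq0 -mulN1r -bmeas_RintegralZl ?area_disc//;
  do ?[exact: measurable_disc|exact: bmeas_Re_mono|by rewrite ltry].
rewrite -(dbar_integral0 a 0 c); apply/eqP.
apply: eq_Rintegral => z _; rewrite /dbar_mono /= mul0r sub0r mul1r mulrN ReN mulN1r.
by [].
Qed.

Lemma moment_conj a b c : moment c a b = moment (conjc c) b a.
Proof.
apply: eq_Rintegral => z _; rewrite /mono.
transitivity (Re (conjc (c * (z ^+ a * z^* ^+ b)))); first by case: (c * _).
by rewrite !rmorphM !rmorphXn /= conjcK [in X in _ * X]mulrC.
Qed.

(** Monomials of different degrees are orthogonal, and the squared norm of [z ^+ a]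
    is [a.+1%:R^-1]. *)
Lemma momentE c a b : moment c a b = if a == b then Re c / a.+1%:R else 0.
Proof.
elim: a b => [|a ih] [|b].
- rewrite eqxx divr1 /moment.
  rewrite -[RHS]mulr1 -[X in _ = _ * X](_ : fine (area R (disc R)) = 1);
    last by rewrite area_disc.
  rewrite -Rintegral_cst; last exact: measurable_disc.
  by apply: eq_Rintegral => z _; rewrite /mono !expr0 !mulr1.
- by rewrite moment_conj moment_a0.
- by rewrite moment_a0.
- have := momentSS a b c; rewrite ih eqSS.
  have b0 : b.+2%:R != 0 :> R by rewrite pnatr_eq0.
  have b1 : b.+1%:R != 0 :> R by rewrite pnatr_eq0.
  case: eqP => [->|_] h; apply: (mulfI b0); rewrite h ?mulr0//.
  by rewrite mulrCA divff// mulr1 mulrCA divff// mulr1.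
Qed.

End Moments.

(** * Parseval's identity and truncated kernels *)

Section Parseval.
Context {R : realType}.
Local Notation C := R[i].
Local Notation Re := (@complex.Re R).
Local Notation Im := (@complex.Im R).
Local Notation normc := Normc.normc.

Lemma mulc_conj (z : C) : z * conjc z = (normc z ^+ 2)%:C.
Proof. by rewrite sqr_normcE; case: z => a b; simpc; congr (_ +i* _); ring. Qed.

Lemma Re_mulrC (z : C) (r : R) : Re (z * r%:C) = Re z * r.
Proof. by rewrite ReM /= mulr0 subr0. Qed.

Lemma normcX (z : C) n : normc (z ^+ n) = normc z ^+ n.
Proof.
elim: n => [|n ih]; first by rewrite !expr0 Normc.normc1.
by rewrite !exprS Normc.normcM ih.
Qed.

Lemma normc_conj (z : C) : normc (conjc z) = normc z.
Proof. by case: z => a b; rewrite /= sqrrN. Qed.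

Lemma normc_real (r : R) : 0 <= r -> normc r%:C = r.
Proof. by move=> r0 /=; rewrite expr0n addr0 sqrtr_sqr ger0_norm. Qed.

Lemma bmeas_normc_sqr d (T : measurableType d) (D : set T) (F : T -> C) : cbmeas D F ->
  bmeas D (fun z => normc (F z) ^+ 2).
Proof.
move=> [rF iF]; under eq_fun do rewrite sqr_normcE.
by apply: bmeasD; exact: bmeasX.
Qed.

Lemma cbmeas_poly n (c : 'I_n -> C) : cbmeas (disc R) (fun z => \sum_(k < n) c k * z ^+ k).
Proof.
apply: cbmeas_sum => k; apply: cbmeasM; first exact: cbmeas_cst.
exact: cbmeasX cbmeas_id.
Qed.

(** The weight [(normc z ^+ 2) ^+ m] shifts both exponents of each monomial by [m],
    so orthogonality is preserved. *)
Lemma parseval n (c : 'I_n -> C) m :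
  \int[area R]_(z in disc R)
     ((normc z ^+ 2) ^+ m * normc (\sum_(k < n) c k * z ^+ k) ^+ 2) =
  \sum_(k < n) normc (c k) ^+ 2 / (k + m).+1%:R.
Proof.
transitivity (\int[area R]_(z in disc R) \sum_(j < n) \sum_(k < n)
    Re (c j * conjc (c k) * mono (j + m) (k + m) z)).
  apply: eq_Rintegral => z _; rewrite mulrC -[normc (\sum_(_ < _) _) ^+ 2]/(Re
    (_%:C)) -mulc_conj.
  rewrite -Re_mulrC rmorphXn /= -mulc_conj exprMn rmorph_sum /= big_distrl /= big_distrl /=
    Re_sum.
  apply: eq_bigr => j _; rewrite big_distrr /= big_distrl /= Re_sum.
  apply: eq_bigr => k _; congr (Re _); rewrite rmorphM rmorphXn /= /mono !exprD.
  by move: (conjc (c k)) (conjc z) => ck w; move: (z ^+ j) (z ^+ m) (w ^+ k) (w ^+ m) => *;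
    ring.
rewrite bmeas_Rintegral_sum; [|exact: measurable_disc|exact: area_disc_fin|]; last first.
  by move=> j; apply: bmeas_sum => k; exact: bmeas_Re_mono.
apply: eq_bigr => j _.
rewrite bmeas_Rintegral_sum; [|exact: measurable_disc|exact: area_disc_fin|]; last first.
  by move=> k; exact: bmeas_Re_mono.
rewrite (bigD1 j)//= big1 ?addr0 => [|k kj].
  by rewrite -/(moment _ _ _) momentE eqxx mulc_conj.
by rewrite -/(moment _ _ _) momentE eqn_add2r eq_sym val_eqE (negbTE kj).
Qed.

Lemma parseval0 n (c : 'I_n -> C) :
  \int[area R]_(z in disc R) (normc (\sum_(k < n) c k * z ^+ k) ^+ 2) =
  \sum_(k < n) normc (c k) ^+ 2 / k.+1%:R.
Proof.
transitivity (\sum_(k < n) normc (c k) ^+ 2 / (k + 0).+1%:R); last first.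
  by apply: eq_bigr => k _; rewrite addn0.
by rewrite -parseval; apply: eq_Rintegral => z _; rewrite expr0 mul1r.
Qed.

Lemma parseval_weight n (c : 'I_n -> C) :
  \int[area R]_(z in disc R)
     ((1 - normc z ^+ 2) ^+ 2 * normc (\sum_(k < n) c k * z ^+ k) ^+ 2) =
  \sum_(k < n) normc (c k) ^+ 2 * (2%:R / (k.+1%:R * k.+2%:R * k.+3%:R)).
Proof.
pose F m z := (normc z ^+ 2) ^+ m * normc (\sum_(k < n) c k * z ^+ k) ^+ 2.
have bF m : bmeas (disc R) (F m).
  by apply: bmeasM; [apply: bmeasX; exact: bmeas_normc_sqr cbmeas_id|exact: bmeas_normc_sqr
    (cbmeas_poly c)].
transitivity (\int[area R]_(z in disc R) (F 0 z - 2%:R * F 1 z + F 2 z)).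
  apply: eq_Rintegral => z _; rewrite /F.
  by move: (normc z ^+ 2) (normc _ ^+ 2) => s t; ring.
have b1 : bmeas (disc R) (fun z => 2%:R * F 1 z) by apply: bmeasM; [exact: bmeas_cst|].
have pF m : \int[area R]_(z in disc R) F m z = _ := parseval c m.
have mD := @measurable_disc R; have fD := @area_disc_fin R.
rewrite bmeas_RintegralD//; last exact: bmeasB.
rewrite bmeas_RintegralB// [X in _ - X]bmeas_RintegralZl// !pF
  big_distrr /= -sumrB -big_split /=.
apply: eq_bigr => k _; rewrite addn0 addn1 addn2.
have e j : j.+1%:R != 0 :> R by rewrite pnatr_eq0.
have := e k; have := e k.+1; have := e k.+2.
move: (normc _ ^+ 2) => s; rewrite -!natr1; move: (k%:R) => t h3 h2 h1; field.
by rewrite h1 h2 h3.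
Qed.

End Parseval.

Section Truncation.

(** Partial sums of [(1 - u) ^- 2] and of [2 * (1 - u) ^- 3]. *)
Definition Ksum (K : pzRingType) N (u : K) := \sum_(k < N) k.+1%:R * u ^+ k.
Definition Asum (K : pzRingType) N (u : K) := \sum_(k < N) (k.+1%:R * k.+2%:R) * u ^+ k.

(** Closed forms, which turn the convergence of both series into a bound on
    powers of [u]. *)
Lemma KsumE (K : comPzRingType) N (u : K) :
  (1 - u) ^+ 2 * Ksum N u = 1 - (N.+1%:R * u ^+ N - N%:R * u ^+ N.+1).
Proof.
elim: N => [|N ih]; first by rewrite /Ksum big_ord0; ring.
rewrite /Ksum big_ord_recr /= mulrDr -/(Ksum N u) ih !exprS -!natr1.
by move: N%:R (u ^+ N) => n v; ring.
Qed.

Lemma AsumE (K : comPzRingType) N (u : K) :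
  (1 - u) ^+ 3 * Asum N u = 2%:R - (N.+1%:R * N.+2%:R * u ^+ N
    - 2%:R * N%:R * N.+2%:R * u ^+ N.+1 + N%:R * N.+1%:R * u ^+ N.+2).
Proof.
elim: N => [|N ih]; first by rewrite /Asum big_ord0; ring.
rewrite /Asum big_ord_recr /= mulrDr -/(Asum N u) ih !exprS -!natr1.
by move: N%:R (u ^+ N) => n v; ring.
Qed.

End Truncation.

(** * Truncation errors and the Schur test *)

Section Estimates.
Context {R : realType}.
Local Notation C := R[i].
Local Notation Re := (@complex.Re R).
Local Notation Im := (@complex.Im R).
Local Notation normc := Normc.normc.

Let natr_S1 n : n.+1%:R = n%:R + 1 :> R. Proof. by rewrite natr1. Qed.
Let natr_S2 n : n.+2%:R = n%:R + 1 + 1 :> R. Proof. by rewrite !natr1. Qed.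
Let natr_S3 n : n.+3%:R = n%:R + 1 + 1 + 1 :> R. Proof. by rewrite !natr1. Qed.

(** The powers [t ^+ i] with [i <= n] are all at least [t ^+ n], and their sum is a
    geometric sum bounded by [(1 - t)^-1]. *)
Lemma succ_mul_expr_le (t : R) n : 0 <= t -> t < 1 -> n.+1%:R * t ^+ n <= (1 - t)^-1.
Proof.
move=> t0 t1; have d0 : 0 < 1 - t by lra.
rewrite -(ler_pM2l d0) divff ?gt_eqF//.
apply: (@le_trans _ _ (1 - t ^+ n.+1)); last first.
  by rewrite lerBlDr lerDl exprn_ge0.
rewrite -[1 in leRHS](expr1n _ n.+1) subrXX ler_wpM2l ?(ltW d0)//.
have -> : n.+1%:R * t ^+ n = \sum_(i < n.+1) t ^+ n.
  by rewrite sumr_const card_ord mulr_natl.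
apply: ler_sum => i _.
rewrite expr1n mul1r; apply: ler_wiXn2l => //; first exact: ltW.
by rewrite -ltnS.
Qed.

(** [N] is so large that both truncated series are, on the disc of radius [r],
    within a relative error of one twentieth of their limits. *)
Definition tail_le (r : R) (N : nat) : Prop :=
  4%:R * (N.+1%:R * N.+2%:R) * r ^+ N <= 20%:R^-1.

Lemma small_tail (r : R) : 0 <= r -> r < 1 -> exists N : nat, tail_le r N.
Proof.
rewrite /tail_le.
move=> r0 r1.
(* With r = t ^ 4, four powers of N.+1 are absorbed and two are needed. *)
pose t := Num.sqrt (Num.sqrt r).
have t0 : 0 <= t by exact: sqrtr_ge0.
have t4 : t ^+ 4 = r by rewrite (exprM _ 2 2) !sqr_sqrtr ?sqrtr_ge0.
have t1 : t < 1.
  by rewrite ltNge; apply/negP => t1; move: r1; rewrite -t4 ltNge exprn_ege1.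
pose B := (1 - t)^-1.
have B0 : 0 < B by rewrite invr_gt0; lra.
have [n hn] : exists n : nat, 160%:R * B ^+ 4 < n%:R.
  by eexists; apply: (le_lt_trans (ler_norm _)); apply: truncnS_gt.
exists n.
have n1 : 0 < n.+1%:R :> R by rewrite ltr0n.
have h : (n.+1%:R * t ^+ n) ^+ 4 <= B ^+ 4.
  by rewrite ler_pXn2r ?nnegrE ?mulr_ge0 ?exprn_ge0 ?ler0n ?(ltW B0)//;
    exact: succ_mul_expr_le.
have hr : r ^+ n = (t ^+ n) ^+ 4 by rewrite -t4 -!exprM mulnC.
rewrite hr; rewrite exprMn in h; move: h hn n1; rewrite (natr_S1 n) (natr_S2 n).
have : 0 <= n%:R :> R by rewrite ler0n.
have : 0 <= (t ^+ n) ^+ 4 by rewrite !exprn_ge0.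
have : 0 <= B ^+ 4 by rewrite exprn_ge0 ?ltW.
move: ((t ^+ n) ^+ 4) (B ^+ 4) (n%:R) => T b m b0 T0 m0 h hn m1.
have h2 : (m + 1) ^+ 2 * T * 160%:R <= 1.
  have : (m + 1) ^+ 2 * ((m + 1) ^+ 2 * T * 160%:R) <= (m + 1) ^+ 2.
    apply: (@le_trans _ _ m); last by nra.
    by apply: le_trans (ltW hn); rewrite (_ : _ * _ = 160%:R * ((m + 1) ^+ 4 * T)); [lra|ring].
  by rewrite -[leRHS]mulr1 ler_pM2l// exprn_gt0.
have h3 : (m + 1) * (m + 1 + 1) * T <= 2%:R * ((m + 1) ^+ 2 * T).
  by rewrite mulrA ler_wpM2r//; nra.
lra.
Qed.

Lemma Ksum_diag_ge (r : R) N (t : R) : 0 <= r -> r < 1 -> tail_le r N ->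
  0 <= t <= r -> 95%:R / 100%:R / (1 - t) ^+ 2 <= Ksum N t.
Proof.
move=> r0 r1 hN /andP[t0 tr]; have d0 : 0 < 1 - t by lra.
rewrite ler_pdivrMr ?exprn_gt0// [Ksum _ _ * _]mulrC KsumE exprS.
have : t ^+ N <= r ^+ N by rewrite lerXn2r ?nnegrE.
have : 0 <= t ^+ N by rewrite exprn_ge0.
have : 0 <= N%:R :> R by rewrite ler0n.
move: hN; rewrite /tail_le (natr_S1 N) (natr_S2 N); move: (t ^+ N) (r ^+ N) N%:R =>
  T rr n h n0 T0 Tr.
have h1 : 0 <= n * (t * T) by rewrite !mulr_ge0.
have h2 : 0 <= (n + 1) * (rr - T) by apply: mulr_ge0; lra.
have h3 : 0 <= (n + 1) ^+ 2 * rr by rewrite mulr_ge0 ?sqr_ge0// (le_trans T0).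
have h4 : 0 <= n * rr by rewrite mulr_ge0// (le_trans T0).
by nra.
Qed.

Lemma Ksum_diag_le N (t : R) : 0 <= t < 1 -> Ksum N t <= ((1 - t) ^+ 2)^-1.
Proof.
move=> /andP[t0 t1]; have d0 : 0 < 1 - t by lra.
rewrite -[leRHS]mul1r ler_pdivlMr ?exprn_gt0// mulrC KsumE exprS (natr_S1 N).
rewrite lerBlDr lerDl; have := exprn_ge0 N t0; have := ler0n R N.
move: (t ^+ N) N%:R => T n n0 T0.
by have := mulr_ge0 (mulr_ge0 n0 T0) (ltW d0); lra.
Qed.

Lemma sum3_le (a b c : C) (p q s : R) : normc a <= p -> normc b <= q -> normc c <= s ->
  normc (a - b + c) <= p + q + s.
Proof.
move=> ha hb hc; apply: le_trans (le_normcD _ _) _; rewrite lerD//.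
by apply: le_trans (le_normcD _ _) _; rewrite lerD// normcN.
Qed.

Lemma normc_nat (n : nat) : normc (n%:R : C) = n%:R.
Proof. by rewrite -(rmorph_nat (real_complex R)) normc_real// ler0n. Qed.

Lemma normc_pow_le (r : R) N (u : C) n : r < 1 -> normc u <= r ->
  normc (u ^+ (n + N)) <= r ^+ N.
Proof.
move=> r1 ur; have r0 := le_trans (normc_ge0 u) ur; rewrite normcX exprD -[leRHS]mul1r
  ler_pM ?exprn_ge0 ?normc_ge0//.
  by rewrite exprn_ile1 ?normc_ge0//; lra.
by rewrite lerXn2r ?nnegrE ?normc_ge0.
Qed.

Lemma one_sub_ge (r : R) (u : C) : normc u <= r -> 1 - r <= normc (1 - u).
Proof.
move=> ur; have : normc (1 : C) <= normc (1 - u) + normc u.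
  by rewrite -[X in normc X <= _](subrK u) le_normcD.
by rewrite Normc.normc1; lra.
Qed.

Lemma one_sub_gt0 (r : R) (u : C) : r < 1 -> normc u <= r -> 0 < normc (1 - u).
Proof. by move=> r1 /one_sub_ge; apply: lt_le_trans; lra. Qed.

Lemma Ksum_le (r : R) N (u : C) : r < 1 -> tail_le r N -> normc u <= r ->
  normc (Ksum N u) <= 105%:R / 100%:R / normc (1 - u) ^+ 2.
Proof.
move=> r1 hN ur; have d0 := one_sub_gt0 r1 ur; have r0 := le_trans (normc_ge0 u) ur.
rewrite ler_pdivlMr ?exprn_gt0// mulrC -normcX -Normc.normcM KsumE.
have h : normc (1 - N.+1%:R * u ^+ N + N%:R * u ^+ N.+1) <= 1 + N.+1%:R * r ^+ N + N%:R *
  r ^+ N.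
  apply: sum3_le; rewrite ?Normc.normc1// Normc.normcM normc_nat ler_wpM2l ?ler0n//.
    exact: (@normc_pow_le r N u 0).
  exact: (@normc_pow_le r N u 1).
rewrite (_ : _ - _ = 1 - N.+1%:R * u ^+ N + N%:R * u ^+ N.+1); last by ring.
apply: le_trans h _.
have : 0 <= r ^+ N by rewrite exprn_ge0.
have : 0 <= N%:R :> R by rewrite ler0n.
move: hN; rewrite /tail_le (natr_S1 N) (natr_S2 N); move: (r ^+ N) N%:R => T n h n0 T0.
have h1 : 0 <= n * T by rewrite mulr_ge0.
have h2 : 0 <= n ^+ 2 * T by rewrite mulr_ge0 ?sqr_ge0.
by lra.
Qed.

Lemma Asum_ge (r : R) N (u : C) : r < 1 -> tail_le r N -> normc u <= r ->
  38%:R / 10%:R / normc (1 - u) ^+ 6 <= normc (Asum N u) ^+ 2.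
Proof.
move=> r1 hN ur; have d0 := one_sub_gt0 r1 ur; have r0 := le_trans (normc_ge0 u) ur.
rewrite ler_pdivrMr ?exprn_gt0// (exprM _ 3 2) -exprMn.
suff h : 195%:R / 100%:R <= normc (Asum N u) * normc (1 - u) ^+ 3.
  apply: (@le_trans _ _ ((195%:R / 100%:R) ^+ 2)); first by lra.
  by rewrite ler_pXn2r ?nnegrE ?mulr_ge0 ?exprn_ge0 ?normc_ge0//; lra.
rewrite [normc (Asum _ _) * _]mulrC -normcX -Normc.normcM.
set w := (1 - u) ^+ 3 * Asum N u.
have : normc (2%:R : C) <= normc w + normc (2%:R - w).
  by rewrite -[X in normc X <= _](subrK w) addrC le_normcD.
rewrite normc_nat /w AsumE subKr.
set v := (X in _ + normc X).
have : normc v <= N.+1%:R * N.+2%:R * r ^+ N + 2%:R * N%:R * N.+2%:R * r ^+ N + N%:R *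
  N.+1%:R * r ^+ N.
  rewrite /v; apply: sum3_le; rewrite !Normc.normcM !normc_nat ler_wpM2l ?mulr_ge0 ?ler0n//.
  - exact: (@normc_pow_le r N u 0).
  - exact: (@normc_pow_le r N u 1).
  - by rewrite -Normc.normcM; exact: (@normc_pow_le r N u 2).
have : 0 <= r ^+ N by rewrite exprn_ge0.
have : 0 <= N%:R :> R by rewrite ler0n.
move: hN; rewrite /tail_le (natr_S1 N) (natr_S2 N); move: (r ^+ N) N%:R (normc v) (normc
  _) => T n V W h n0 T0 hv hw.
have h1 : 0 <= n * T by rewrite mulr_ge0.
have h2 : 0 <= n ^+ 2 * T by rewrite mulr_ge0 ?sqr_ge0.
by lra.
Qed.

Lemma ge0_measurable_funV d (T : measurableType d) (f : T -> R) :
  (forall x, 0 <= f x) -> measurable_fun setT f -> measurable_fun setT (fun x => (f x)^-1).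
Proof.
move=> f0 mf; under eq_fun do rewrite -powR_inv1//.
exact: (measurableT_comp (measurable_powR (-1)) mf).
Qed.

Lemma cbmeas_one_subJ (x : C) : cbmeas (disc R) (fun y => 1 - x * conjc y).
Proof.
apply: cbmeasB; first exact: cbmeas_cst.
by apply: cbmeasM; [exact: cbmeas_cst|apply: cbmeas_conj; exact: cbmeas_id].
Qed.

(** For fixed [x] this is, up to the factor [(1 - normc x ^+ 2) ^+ 2], the modulus of
    the cube of the Bergman kernel divided by its values at [(x, x)] and [(y, y)]. *)
Definition schur_fun (x y : C) : R := (1 - normc y ^+ 2) ^+ 2 / normc (1 - x * conjc y) ^+ 6.

Lemma normc_mulJ_le (r : R) (x y : C) : normc x <= r -> disc R y -> normc (x * conjc y) <= r.
Proof.
move=> xr /discE y1; rewrite Normc.normcM normc_conj -[leRHS]mulr1.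
by rewrite ler_pM ?normc_ge0 ?(ltW y1).
Qed.

Lemma schur_ge0 (x y : C) : 0 <= schur_fun x y.
Proof. by rewrite /schur_fun divr_ge0 ?sqr_ge0// exprn_ge0 ?normc_ge0. Qed.

Lemma measurable_schur_fun (x : C) : measurable_fun setT (schur_fun x).
Proof.
apply: measurable_funM.
  by apply: (bmeasX (D := disc R) 2 _).1; apply: bmeasB; [exact: bmeas_cst|exact:
    bmeas_normc_sqr cbmeas_id].
apply: ge0_measurable_funV => [y|]; first by rewrite exprn_ge0 ?normc_ge0.
under eq_fun do rewrite (exprM _ 2 3).
exact: (bmeasX 3 (bmeas_normc_sqr (cbmeas_one_subJ x))).1.
Qed.

Lemma bmeas_schur_fun (r : R) (x : C) : r < 1 -> normc x <= r -> bmeas (disc R) (schur_fun x).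
Proof.
move=> r1 xr; split; first exact: measurable_schur_fun.
have d0 : 0 < 1 - r by rewrite subr_gt0.
exists (((1 - r) ^+ 6)^-1) => y Dy; rewrite ger0_norm ?schur_ge0// /schur_fun -[leRHS]mul1r.
have hy : 1 - r <= normc (1 - x * conjc y) by apply: one_sub_ge; exact: normc_mulJ_le.
apply: ler_pM; rewrite ?sqr_ge0 ?invr_ge0 ?exprn_ge0 ?normc_ge0//.
  have /discE y1 := Dy; rewrite exprn_ile1//.
    by rewrite subr_ge0 exprn_ile1 ?normc_ge0 ?(ltW y1).
  by rewrite lerBlDr lerDl sqr_ge0.
rewrite lef_pV2 ?posrE ?exprn_gt0 ?(lt_le_trans d0)//.
by rewrite lerXn2r ?nnegrE ?(ltW d0)// (le_trans (ltW d0)).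
Qed.

(** Expanding [(1 - x * conjc y) ^- 3] into a power series in [conjc y], Parseval
    with the weight [(1 - normc y ^+ 2) ^+ 2] gives a series with coefficients at most
    [k.+1%:R / 2], that is at most half of the series of [(1 - normc x ^+ 2) ^- 2].
    The constant [10 / 19] instead of [1 / 2] pays for the truncation at [N]. *)
Lemma schur_bound (r : R) N (x : C) : r < 1 -> tail_le r N -> normc x <= r ->
  \int[area R]_(y in disc R) schur_fun x y <= 10%:R / 19%:R / (1 - normc x ^+ 2) ^+ 2.
Proof.
move=> r1 hN xr.
have x2 : 0 <= normc x ^+ 2 < 1.
  by rewrite exprn_ge0 ?normc_ge0//= exprn_ilt1 ?normc_ge0//; lra.
pose c (k : 'I_N) : C := (k.+1%:R * k.+2%:R) * (conjc x) ^+ k.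
have cE y : normc (\sum_(k < N) c k * y ^+ k) = normc (Asum N (x * conjc y)).
  rewrite -normc_conj /Asum; congr (normc _); rewrite rmorph_sum /=.
  apply: eq_bigr => k _; rewrite /c !rmorphM !rmorphXn /= conjcK !conjc_nat exprMn.
  by rewrite !mulrA.
have bG : bmeas (disc R) (fun y => (1 - normc y ^+ 2) ^+ 2 * normc (\sum_(k < N) c k *
  y ^+ k) ^+ 2).
  apply: bmeasM; last exact: bmeas_normc_sqr (cbmeas_poly c).
  by apply: bmeasX; apply: bmeasB; [exact: bmeas_cst|exact: bmeas_normc_sqr cbmeas_id].
have pt y : disc R y -> schur_fun x y <=
    10%:R / 38%:R * ((1 - normc y ^+ 2) ^+ 2 * normc (\sum_(k < N) c k * y ^+ k) ^+ 2).
  move=> Dy; rewrite mulrCA ler_wpM2l ?sqr_ge0// cE.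
  by have := Asum_ge r1 hN (normc_mulJ_le xr Dy); move: (normc (Asum _ _) ^+ 2) (_ ^+ 6) =>
    S T; lra.
have bS := bmeas_schur_fun r1 xr.
apply: (@le_trans _ _ (\int[area R]_(y in disc R) (10%:R / 38%:R *
   ((1 - normc y ^+ 2) ^+ 2 * normc (\sum_(k < N) c k * y ^+ k) ^+ 2)))).
  by apply: bmeas_le_Rintegral => //; [exact: measurable_disc|exact: area_disc_fin|apply:
    bmeasM => //; exact: bmeas_cst].
rewrite bmeas_RintegralZl//; [|exact: measurable_disc|exact: area_disc_fin].
rewrite parseval_weight.
apply: (@le_trans _ _ (10%:R / 38%:R * (2%:R * Ksum N (normc x ^+ 2)))); last first.
  by have := Ksum_diag_le N x2; move: (Ksum _ _) (_^-1) => a b; lra.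
rewrite ler_wpM2l//.
rewrite /Ksum big_distrr /=; apply: ler_sum => k _.
rewrite /c !Normc.normcM !normc_nat normcX normc_conj -[(normc x ^+ 2) ^+ k]exprM
  !exprMn -exprM [(k * 2)%N]mulnC.
have e j : 0 < j.+1%:R :> R by rewrite ltr0n.
have := e k; have := e k.+1; have := e k.+2.
have : 0 <= normc x ^+ (2 * k) by rewrite exprn_ge0 ?normc_ge0.
rewrite (natr_S1 k) (natr_S2 k) (natr_S3 k); move: (_ ^+ (2 * k)) (k%:R) => s t s0 h3 h2 h1.
rewrite (_ : _ * (2%:R / _) = 2%:R * ((t + 1) * s) * ((t + 1 + 1) / (t + 1 + 1 + 1)));
  last first.
  by field; rewrite !gt_eqF.
rewrite -[leRHS]mulr1 ler_wpM2l//; first by nra.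
by rewrite ler_pdivrMr//; lra.
Qed.

End Estimates.

(** * Topology of the disc and holomorphy of polynomials *)

Section Topology.
Context {R : realType}.
Local Notation C := R[i].
Local Notation Re := (@complex.Re R).
Local Notation Im := (@complex.Im R).
Local Notation normc := (@Normc.normc R).

Lemma normCE (z : C) : `|z| = (normc z)%:C.
Proof. by rewrite normc_def; case: z. Qed.

Lemma pos_complex (e : C) : 0 < e -> exists2 d : R, 0 < d & e = d%:C.
Proof.
by case: e => a b; rewrite ltcE /= => /andP[/eqP b0 a0]; exists a => //; rewrite b0.
Qed.

Lemma continuous_normc : continuous (normc : C -> R).
Proof.
move=> z; have FF := @nbhs_filter C z; apply/(@cvgrPdist_lt _ _ _ _ FF) => e e0.
have e0' : 0 < e%:C by rewrite ltcR.
apply/nbhs_ballP; exists e%:C => //= t; rewrite -ball_normE /= normCE ltcR.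
apply: le_lt_trans.
rewrite ler_norml; apply/andP; split.
  by rewrite lerNl opprB lerBlDr -(normcN (z - t)) opprB -[X in normc X <= _](subrK z)
    le_normcD.
by rewrite lerBlDr -[X in normc X <= _](subrK t) le_normcD.
Qed.

Lemma continuous_of_plane : continuous (@of_plane R).
Proof.
move=> [x y]; apply/cvgrPdist_lt => e /pos_complex[d d0 ->].
have d2 : 0 < d / 2 by rewrite divr_gt0.
exists (ball x (d / 2), ball y (d / 2)); first by split; exact: nbhsx_ballx.
move=> p [] /=; rewrite -!ball_normE /= => px py.
rewrite normCE ltcR.
rewrite -(@ltr_pXn2r _ 2) ?nnegrE ?normc_ge0 ?ltW// sqr_normcE /=.
have := real_normK (num_real (x - p.1)); have := real_normK (num_real (y - p.2)).
move=> <- <-; have := normr_ge0 (x - p.1); have := normr_ge0 (y - p.2).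
move: px py; move: `|_ - p.1| `|_ - p.2| => s t hs ht t0 s0.
nra.
Qed.

(** It is a closed subset of the continuous image of a compact square. *)
Lemma compact_closed_disc (r : R) : compact [set z : C | normc z <= r].
Proof.
have sub : [set z : C | normc z <= r] `<=` @of_plane R @` (`[-r, r] `*` `[-r, r]).
  move=> [x y] /= h; exists (x, y) => //=; rewrite !in_itv /= -!ler_norml.
  have r0 := le_trans (sqrtr_ge0 _) h.
  have : x ^+ 2 + y ^+ 2 <= r ^+ 2.
    rewrite -[leLHS]sqr_sqrtr ?addr_ge0 ?sqr_ge0//.
    by rewrite ler_pXn2r ?nnegrE ?sqrtr_ge0.
  by move=> {}h; split; rewrite -(@ler_pXn2r _ 2) ?nnegrE// real_normK ?num_real//;
    have := sqr_ge0 x; have := sqr_ge0 y; lra.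
apply: subclosed_compact sub.
  apply: (@preimage_closed _ _ _ [set x : R | x <= r]); last exact: closed_le.
  by move=> z _; exact: continuous_normc.
apply: continuous_compact.
  by apply: continuous_subspaceT; exact: continuous_of_plane.
by apply: compact_setX; exact: segment_compact.
Qed.

Lemma compact_sub_disc (K : set C) : compact K -> K `<=` disc R ->
  exists r : R, [/\ 0 <= r, r < 1 & K `<=` [set z | normc z <= r]].
Proof.
move=> cK KD; have [->|/set0P K0] := eqVneq K set0.
  by exists 0; split => //; exact: sub0set.
have [c cK0 hc] : exists2 c, c \in K & forall t, t \in K -> normc t <= normc c.
  by apply: compact_EVT_max => //; apply: continuous_subspaceT; exact: continuous_normc.
exists (normc c); split => [| |z Kz]; first exact: normc_ge0.
  by apply/discE/KD; rewrite -inE.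
by apply: hc; rewrite inE.
Qed.

Lemma holomorphic_poly n (c : 'I_n -> C) :
  holomorphic_on_disc (fun z => \sum_(k < n) c k * z ^+ k).
Proof.
move=> z _.
rewrite (_ : (fun z => _) = \sum_(k < n) (fun z : C => c k * z ^+ k)); last first.
  by apply/funext => t; rewrite fct_sumE.
apply: derivable_sum => k.
have h : derivable (fun t : C => t ^+ k) z 1.
  elim: (nat_of_ord k) => [|m ih].
    rewrite (_ : (fun t : C => t ^+ 0) = cst 1); last by apply/funext => t; rewrite expr0.
    exact: derivable_cst.
  rewrite (_ : (fun t : C => t ^+ m.+1) = id * (fun t : C => t ^+ m)).
    exact: (@derivableM C C id (fun t : C => t ^+ m) z 1 (@derivable_id C C z 1) ih).
  by apply/funext => t; rewrite exprS.
have e : (fun t : C => c k * t ^+ k) = cst (c k) * (fun t : C => t ^+ k).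
  by apply/funext => t.
rewrite e.
have hc : derivable (cst (c k) : C -> C) z 1 by exact: derivable_cst.
exact: (@derivableM C C (cst (c k)) (fun t : C => t ^+ k) z 1 hc h).
Qed.

End Topology.

(** * Linear statistics of a configuration *)

Section ConfSums.
Context {R : realType}.
Local Notation C := R[i].
Local Notation normc := (@Normc.normc R).

Definition closed_disc (r : R) : set C := [set z | normc z <= r].

Definition supported (V : nmodType) (r : R) (F : C -> V) :=
  forall x, r < normc x -> F x = 0.

Lemma closed_disc_sub (r : R) : r < 1 -> closed_disc r `<=` disc R.
Proof. by move=> r1 z zr; apply/discE/(le_lt_trans zr). Qed.

Lemma measurable_normc : measurable_fun setT (normc : C -> R).
Proof.
rewrite (_ : normc = fun z => Num.sqrt (complex.Re z ^+ 2 + complex.Im z ^+ 2)); last first.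
  by apply/funext => -[].
apply: (@measurableT_comp _ _ _ _ _ _ (@Num.sqrt R)).
  by apply: continuous_measurable_fun => x; exact: sqrt_continuous.
by apply: measurable_funD; apply: measurable_funX; [exact: measurable_Re|exact: measurable_Im].
Qed.

Lemma measurable_closed_disc r : measurable (closed_disc r).
Proof.
rewrite (_ : closed_disc r = normc @^-1` `]-oo, r]).
  by rewrite -[X in measurable X]setTI; exact: measurable_normc.
by apply/seteqP; split => z /=; rewrite in_itv.
Qed.

Lemma relatively_compact_closed_disc r B : r < 1 -> B `<=` closed_disc r ->
  relatively_compact B.
Proof.
move=> r1 Br; exists (closed_disc r).
by split=> //; [exact: compact_closed_disc|exact: closed_disc_sub].
Qed.

Section fixX.
Variables (r : R) (r1 : r < 1).

Definition pts (X : configuration R) : seq C :=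
  finmap.enum_fset (fset_set [set x | closed_disc r x /\ X x != 0%N]).

Lemma finite_pts (X : configuration R) :
  finite_set [set x | closed_disc r x /\ X x != 0%N].
Proof.
apply: (@mult_locally_finite _ X (closed_disc r)); first exact: compact_closed_disc.
exact: closed_disc_sub.
Qed.

Lemma mem_pts X x : (x \in pts X) = ((normc x <= r) && (X x != 0%N)).
Proof.
rewrite in_fset_set; last exact: finite_pts.
by apply/idP/idP; rewrite inE /closed_disc /= => /andP.
Qed.

(** For a summand supported in a closed disc the sum is a finite sum over a
    list that does not depend on the summand, so all the linear algebra of
    statistics reduces to that of finite sums. *)
Lemma conf_sum_pts (V : nmodType) X (F : C -> V) : supported r F ->
  conf_sum X F = \sum_(x <- pts X) F x *+ X x.
Proof.
move=> sF; rewrite /conf_sum (fsbigE (pts X)) //.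
- rewrite big_mkcond; apply: eq_big_seq => x; rewrite mem_pts => /andP[xr _].
  by rewrite ifT// inE; exact: closed_disc_sub xr.
- by rewrite /pts finmap.fset_uniq.
- move=> x /=; rewrite mem_pts => /andP[xr _].
  exact: closed_disc_sub xr.
- move=> x _; rewrite mem_pts negb_and => /orP[|].
    by rewrite -ltNge => /sF ->; rewrite mul0rn.
  by rewrite negbK => /eqP ->; rewrite mulr0n.
Qed.

Lemma conf_sumD (V : nmodType) X (F G : C -> V) : supported r F -> supported r G ->
  conf_sum X (fun x => F x + G x) = conf_sum X F + conf_sum X G.
Proof.
move=> sF sG; rewrite !conf_sum_pts//; last by move=> x rx; rewrite sF// sG// addr0.
by rewrite -big_split; apply: eq_bigr => x _; rewrite mulrnDl.
Qed.

Lemma conf_sumZ X (F : C -> R) c : supported r F ->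
  conf_sum X (fun x => c * F x) = c * conf_sum X F.
Proof.
move=> sF; rewrite !conf_sum_pts//; last by move=> x rx; rewrite sF// mulr0.
by rewrite big_distrr; apply: eq_bigr => x _; rewrite -mulrnAr.
Qed.

Lemma conf_sumB X (F G : C -> R) : supported r F -> supported r G ->
  conf_sum X (fun x => F x - G x) = conf_sum X F - conf_sum X G.
Proof.
move=> sF sG.
rewrite conf_sumD//; last by move=> x rx; rewrite sG// oppr0.
by congr (_ + _); rewrite -mulN1r -conf_sumZ//; congr conf_sum; apply/funext => x;
  rewrite mulN1r.
Qed.

Lemma conf_sum_ge0 X (F : C -> R) : (forall x, 0 <= F x) -> 0 <= conf_sum X F.
Proof.
move=> F0; apply: sumr_ge0 => x _; by rewrite mulrn_wge0.
Qed.

(** A point of multiplicity [m] carries [m] labels. *)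
Lemma esum_labelled X (u : C -> R) : (forall x, 0 <= u x) -> supported r u ->
  (\esum_(p in labelled_points X) (u p.1)%:E)%E = (conf_sum X u)%:E.
Proof.
move=> u0 su.
have -> : labelled_points X = setT `*`` (fun x => `I_(X x)).
  by apply/seteqP; split => -[x k] //= [].
rewrite -(@esum_esum _ _ _ setT (fun x => `I_(X x)) (fun x _ => (u x)%:E)); last first.
  by move=> x k _ _; rewrite lee_fin.
have inner x : (\esum_(k in `I_(X x)) (u x)%:E)%E = (u x *+ X x)%:E.
  rewrite esum_fset//; last by move=> ? _; rewrite lee_fin.
  rewrite -fsbig_ord sumEFin; congr EFin.
  by rewrite big_const_ord iter_addr_0.
under eq_esum do rewrite inner.
pose A := [set x | closed_disc r x /\ X x != 0%N].
rewrite (esumID A) => [|x _]; last by rewrite lee_fin mulrn_wge0.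
rewrite setTI [X in (_ + X)%E]esum1 ?adde0 => [|x [_ /not_andP[]]]; last 2 first.
- by move=> /negP; rewrite -ltNge => /su ->; rewrite mul0rn.
- by move=> /negP; rewrite negbK => /eqP ->.
rewrite esum_fset; [|exact: finite_pts|by move=> x _; rewrite lee_fin mulrn_wge0].
rewrite fsbig_finite; last exact: finite_pts.
by rewrite conf_sum_pts// sumEFin.
Qed.

Lemma distinct_sum1 X (u : C -> R) : (forall x, 0 <= u x) -> supported r u ->
  distinct_sum X (fun t : 1.-tuple C => (u (tnth t ord0))%:E) = (conf_sum X u)%:E.
Proof.
move=> u0 su; rewrite -esum_labelled// /distinct_sum.
rewrite (@reindex_esum _ _ _ (labelled_points X) _ (fun p => [tuple p])).
  by apply: eq_esum => p _.
split.
- by move=> p Lp; split => // q; rewrite inE => /eqP ->.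
- by move=> p q _ _ /(congr1 (fun t => tnth t ord0)).
- move=> s [_ Ls]; exists (thead s); last first.
    by apply/val_inj; case/tupleP: s {Ls} => a s; rewrite /= [s]tuple0.
  by apply: Ls; exact: mem_tnth.
Qed.

(** The product of two linear statistics is a sum over all pairs of labelled points;
    removing the diagonal pairs, which labels make well defined at multiple points,
    leaves the sum over the distinct ones. *)
Lemma distinct_sum2 X (u v : C -> R) : (forall x, 0 <= u x) -> (forall x, 0 <= v x) ->
  supported r u -> supported r v ->
  distinct_sum X (fun t : 2.-tuple C => (u (tnth t ord0) * v (tnth t (lift ord0 ord0)))%:E) =
  (conf_sum X u * conf_sum X v - conf_sum X (fun x => u x * v x))%:E.
Proof.
move=> u0 v0 su sv.
have suv : supported r (fun x => u x * v x) by move=> x rx; rewrite su// mul0r.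
have uv0 x y : 0 <= u x * v y by rewrite mulr_ge0.
pose L := labelled_points X.
pose ne : set ((C * nat) * (C * nat)) := [set pq | pq.1 != pq.2].
have all : (\esum_(pq in L `*`` (fun=> L)) (u pq.1.1 * v pq.2.1)%:E)%E =
    (conf_sum X u * conf_sum X v)%:E.
  rewrite -(@esum_esum _ _ _ L (fun=> L) (fun p q => (u p.1 * v q.1)%:E)); last first.
    by move=> p q _ _; rewrite lee_fin.
  under eq_esum => p _.
    rewrite (@esum_labelled X (fun x => u p.1 * v x)); last 2 first.
    - by move=> x.
    - by move=> x rx; rewrite sv// mulr0.
    rewrite conf_sumZ// mulrC; over.
  rewrite (@esum_labelled X (fun x => conf_sum X v * u x)); last 2 first.
  - by move=> x; rewrite mulr_ge0// conf_sum_ge0.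
  - by move=> x rx; rewrite su// mulr0.
  by rewrite conf_sumZ// mulrC.
have diag : (\esum_(pq in (L `*`` (fun=> L)) `&` ~` ne) (u pq.1.1 * v pq.2.1)%:E)%E =
    (conf_sum X (fun x => u x * v x))%:E.
  rewrite -esum_labelled// (@reindex_esum _ _ _ L _ (fun p => (p, p))).
    by apply: eq_esum => p _.
  split.
  - by move=> p Lp; split => //=; rewrite /ne /= eqxx.
  - by move=> p q _ _ [].
  - by move=> [p q] [[/= Lp _]]; rewrite /ne /= => /negP; rewrite negbK => /eqP <-; exists p.
have off : (\esum_(pq in (L `*`` (fun=> L)) `&` ne) (u pq.1.1 * v pq.2.1)%:E)%E =
    distinct_sum X (fun t : 2.-tuple C => (u (tnth t ord0) * v (tnth t (lift ord0 ord0)))%:E).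
  apply/esym; rewrite /distinct_sum.
  rewrite (@reindex_esum _ _ _ ((L `*`` (fun=> L)) `&` ne) _ (fun pq => [tuple pq.1; pq.2])).
    by apply: eq_esum => p _.
  split.
  - move=> [p q] [[/= Lp Lq] pq]; split; first by rewrite /= inE andbT.
    by move=> s; rewrite !inE => /orP[] /eqP ->.
  - by move=> [p q] [p' q'] _ _ /(congr1 val) [-> ->].
  - move=> s [us Ls]; exists (tnth s ord0, tnth s (lift ord0 ord0)).
      split; first by split => /=; apply: Ls; exact: mem_tnth.
      by rewrite /ne /=; case/tupleP: s us {Ls} => a s; case/tupleP: s => b s;
        rewrite /= inE negb_or -andbA => /and3P[].
    apply/val_inj => /=; case/tupleP: s {us Ls} => a s; case/tupleP: s => b s.
    by rewrite [s]tuple0.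
have := all; rewrite (esumID ne) => [|pq _]; last by rewrite lee_fin.
rewrite off diag => h; rewrite EFinB -h addeK//.
Qed.

End fixX.
End ConfSums.

(** * Measurability of linear statistics *)

Section Measurability.
Context {R : realType}.
Local Notation C := R[i].
Local Notation normc := (@Normc.normc R).

Lemma measurable_conf_count (B : set C) : measurable B -> relatively_compact B ->
  measurable_fun setT (fun X : Conf R => (conf_count X B)%:R : R).
Proof.
move=> mB rB _ Y mY; rewrite setTI.
rewrite (_ : _ @^-1` Y = \bigcup_(k in [set k : nat | Y k%:R]) [set X : Conf R |
  conf_count X B = k]).
  apply: bigcup_measurable => k _; apply: sub_sigma_algebra.
  by exists B, k.
by apply/seteqP; split => [X YX|X [k /= Yk Xk]]; [exists (conf_count X B)|rewrite /= Xk].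
Qed.

Lemma cvg_sum_seq (T : eqType) (s : seq T) (f : T -> nat -> R) (a : T -> R) :
  {in s, forall x, f x n @[n --> \oo] --> a x} ->
  \sum_(x <- s) f x n @[n --> \oo] --> \sum_(x <- s) a x.
Proof.
elim: s => [|x s ih] h.
  rewrite big_nil; under eq_fun do rewrite big_nil; exact: cvg_cst.
rewrite big_cons; under eq_fun do rewrite big_cons; apply: cvgD.
  by apply: h; rewrite mem_head.
by apply: ih => y ys; apply: h; rewrite inE ys orbT.
Qed.

Variables (r : R) (r1 : r < 1).

Lemma conf_count_indic (X : configuration R) (B : set C) : B `<=` closed_disc r ->
  (conf_count X B)%:R = conf_sum X (fun x => \1_B x : R).
Proof.
move=> Br.
have h x : r < normc x -> (x \in B) = false.
  by move=> rx; apply/negbTE/negP; rewrite inE => /Br; rewrite /closed_disc /= leNgt rx.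
rewrite /conf_count !(conf_sum_pts r1).
- rewrite natr_sum; apply: eq_bigr => x _; rewrite indicE.
  by elim: (X x) => [|n ih]; rewrite ?mulr0n// !mulrS natrD ih.
- by move=> x /h xB; rewrite indicE xB.
- by move=> x /h ->.
Qed.

Import HBNNSimple.

(** The sigma-algebra on configurations only knows about counts in relatively
    compact sets. Simple functions cut off to the closed disc give combinations of
    such counts, and for each configuration the limit passes through a finite sum. *)
Lemma measurable_conf_sum_ge0 (u : C -> R) : measurable_fun setT u ->
  (forall x, 0 <= u x) -> supported r u ->
  measurable_fun setT (fun X : Conf R => conf_sum X u).
Proof.
move=> mu u0 su.
pose B := closed_disc r.
pose h := nnsfun_approx measurableT ((measurable_EFinP _ _).2 mu).
have hcvg x : (h n x) @[n --> \oo] --> u x.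
  have e0 y : setT y -> (0 <= (EFin \o u) y)%E by rewrite lee_fin.
  have /fine_cvgP[_] := @cvg_nnsfun_approx _ _ _ _ measurableT _ ((measurable_EFinP _ _).2
    mu) e0 x Logic.I.
  exact.
apply: (measurable_fun_cvg (h := fun n (X : Conf R) => conf_sum X (fun x => h n x * \1_B x))).
  move=> n.
  pose s := finmap.enum_fset (fset_set (h n @` setT)).
  rewrite (_ : (fun X : Conf R => _) = (fun X : Conf R => \sum_(i < size s)
     s`_i * (conf_count X ((h n @^-1` [set s`_i]) `&` B))%:R)).
    apply: measurable_sum => i; apply: measurable_funM; first exact: measurable_cst.
    apply: measurable_conf_count.
      by apply: measurableI; [|exact: measurable_closed_disc].
    by apply: (relatively_compact_closed_disc r1) => x [].
  apply/funext => X.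
  have sB i : supported r (fun x => s`_i * \1_((h n @^-1` [set s`_i]) `&` B) x).
    move=> x rx; rewrite indicE memNset ?mulr0// => -[_].
    by rewrite /B /closed_disc /= leNgt rx.
  transitivity (\sum_(i < size s) conf_sum X (fun x => s`_i * \1_((h n @^-1` [set s`_i]) `&`
    B) x)).
    rewrite (conf_sum_pts r1); last first.
      by move=> x rx; rewrite indicE memNset ?mulr0// /B /closed_disc /= leNgt rx.
    under [RHS]eq_bigr do rewrite (conf_sum_pts r1)//.
    rewrite exchange_big /=; apply: eq_bigr => x _.
    rewrite sumrMnl; congr (_ *+ _).
    rewrite fimfunEord big_distrl /= ; apply: eq_bigr => i _.
    by rewrite -mulrA indicI.
  apply: eq_bigr => i _.
  rewrite (conf_sumZ r1) ?conf_count_indic//.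
  - by move=> x rx; rewrite indicE memNset// => -[_]; rewrite /B /closed_disc /= leNgt rx.
move=> X _.
rewrite (conf_sum_pts r1 X su).
have sh n : supported r (fun x => h n x * \1_B x).
  by move=> x rx; rewrite indicE memNset ?mulr0// /B /closed_disc /= leNgt rx.
rewrite (_ : (fun n => _) = fun n => \sum_(x <- pts r X) (h n x * \1_B x) *+ X x); last first.
  by apply/funext => n; rewrite (conf_sum_pts r1).
have key : {in pts r X, forall x, (h n x * \1_B x) *+ X x @[n --> \oo] --> u x *+ X x}.
  move=> x; rewrite mem_pts// => /andP[xr _].
  have xB : \1_B x = 1 :> R by rewrite indicE mem_set.
  rewrite xB; under eq_fun do rewrite mulr1.
  elim: (X x) => [|m ih].
    by under eq_fun do rewrite mulr0n; exact: cvg_cst.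
  by under eq_fun do rewrite mulrS; rewrite mulrS; apply: cvgD; [exact: hcvg|].
exact: (@cvg_sum_seq _ (pts r X) (fun x n => (h n x * \1_B x) *+ X x) _ key).
Qed.

End Measurability.

(** * The area of the disc as a probability measure *)

Section DiscMeasure.
Context {R : realType}.
Local Notation C := R[i].
Local Notation normc := (@Normc.normc R).

(** The restriction of [area] to the disc is a probability measure on the whole
    plane, hence sigma-finite, which the Fubini theorems require. *)
Definition disc_area : set C -> \bar R := mrestr (area R) (@measurable_disc R).

HB.instance Definition _ := Measure.on disc_area.

Lemma disc_area_setT : disc_area setT = 1%E.
Proof. by rewrite /disc_area /mrestr setTI area_disc. Qed.

HB.instance Definition _ :=
  Measure_isProbability.Build _ _ _ disc_area disc_area_setT.

(** [area] is the sum of its restrictions to the disc and to its complement. *)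
Lemma ge0_integral_disc_area (f : C -> \bar R) : measurable_fun setT f ->
  (forall x, 0 <= f x)%E ->
  (\int[area R]_(x in disc R) f x = \int[disc_area]_x f x)%E.
Proof.
move=> mf f0.
have mD := @measurable_disc R; have mDC := measurableC mD.
have e : (\int[area R]_(x in disc R) f x =
    \int[measure_add (disc_area : {measure set C -> \bar R}) (mrestr (area R) mDC)]_(x in
      disc R) f x)%E.
  apply: eq_measure_integral => A mA AD.
  apply/esym; apply: etrans (measure_addE _ _ _) _; rewrite /= /disc_area /mrestr /=.
  rewrite (_ : A `&` disc R = A); last exact: setIidl.
  rewrite (_ : A `&` ~` _ = set0) ?measure0 ?adde0//.
  by apply/seteqP; split => // x [/AD].
rewrite e ge0_integral_measure_add//; last exact: measurable_funTS.
rewrite [X in (_ + X)%E]null_set_integral ?adde0//; last 2 first.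
- exact: measurable_funTS.
- by rewrite /= /mrestr setICr measure0.
rewrite [RHS](_ : _ = \int[disc_area]_(x in disc R `|` ~` disc R) f x)%E;
  last by rewrite setUv.
rewrite ge0_integral_setU//.
- rewrite [X in (_ + X)%E]null_set_integral ?adde0//.
    exact: measurable_funTS.
  by rewrite /= /disc_area /mrestr setICl measure0.
- by rewrite setUv.
- by apply/disj_setPS => x [].
Qed.

End DiscMeasure.

(** * The Bergman kernel as a real function *)

Section Kernels.
Context {R : realType}.
Local Notation C := R[i].
Local Notation normc := (@Normc.normc R).
Local Notation Re := (@complex.Re R).

(** The diagonal values of the Bergman kernel, and the squared modulus of the kernel,
    as real functions on the plane. *)
Definition kdiag (x : C) : R := ((1 - normc x ^+ 2) ^+ 2)^-1.
Definition ksqr (x y : C) : R := (normc (1 - x * conjc y) ^+ 4)^-1.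

Lemma bergman_kernelM (x y : C) :
  bergman_kernel x y * bergman_kernel y x = (ksqr x y)%:C.
Proof.
rewrite /bergman_kernel /ksqr -invfM -exprMn.
have -> : 1 - y * conjc x = conjc (1 - x * conjc y).
  by rewrite rmorphB rmorph1 rmorphM /= conjcK mulrC.
by rewrite mulc_conj -rmorphXn -exprM fmorphV.
Qed.

Lemma bergman_kernel_diag (x : C) : bergman_kernel x x = (kdiag x)%:C.
Proof.
by rewrite /bergman_kernel /kdiag mulc_conj -(rmorph1 (real_complex R)) -rmorphB -rmorphXn
  fmorphV.
Qed.

Lemma det_bergman1 (t : 1.-tuple C) :
  Re (\det (\matrix_(i < 1, j < 1) bergman_kernel (tnth t i) (tnth t j))) =
  kdiag (tnth t ord0).
Proof. by rewrite det_mx11 mxE bergman_kernel_diag. Qed.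

Lemma det_bergman2 (t : 2.-tuple C) (x := tnth t ord0) (y := tnth t (lift ord0 ord0)) :
  Re (\det (\matrix_(i < 2, j < 2) bergman_kernel (tnth t i) (tnth t j))) =
  kdiag x * kdiag y - ksqr x y.
Proof.
rewrite (expand_det_row _ ord0) !big_ord_recl big_ord0 addr0 /cofactor !det_mx11 !mxE.
rewrite /= expr0 mul1r (_ : (-1) ^+ (0 + bump 0 0) = -1) ?expr1// mulN1r mulrN.
rewrite (_ : lift (lift ord0 ord0) ord0 = ord0); last exact/val_inj.
rewrite -/x -/y !bergman_kernel_diag bergman_kernelM.
by rewrite -rmorphM -rmorphB.
Qed.

Lemma bmeas_sub d (T : measurableType d) (A B : set T) (f : T -> R) : A `<=` B ->
  bmeas B f -> bmeas A f.
Proof. by move=> AB [mf [M hM]]; split => //; exists M => x /AB /hM. Qed.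

Lemma bmeasV d (T : measurableType d) (A : set T) (f : T -> R) c : 0 < c ->
  (forall x, 0 <= f x) -> (forall x, A x -> c <= f x) -> measurable_fun setT f ->
  bmeas A (fun x => (f x)^-1).
Proof.
move=> c0 f0 fc mf; split; first exact: ge0_measurable_funV.
exists c^-1 => x /fc cx; rewrite ger0_norm ?invr_ge0//.
by rewrite lef_pV2 ?posrE// (lt_le_trans c0).
Qed.

(** A factor that blows up at the boundary of the disc is harmless against a function
    supported away from it. *)
Lemma bmeas_mulr_supp d (T : measurableType d) (A : set T) (u g : T -> R) :
  bmeas setT u -> (forall x, ~ A x -> u x = 0) -> bmeas A g -> bmeas setT (fun x => u x * g x).
Proof.
move=> [mu [M hM]] u0 [mg [N hN]]; split; first exact: measurable_funM.
exists (`|M| * `|N|) => x _; have [Ax|/u0 ->] := pselect (A x); last first.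
  by rewrite mul0r normr0 mulr_ge0.
by rewrite normrM ler_pM// (le_trans _ (ler_norm _)) ?hM ?hN.
Qed.

Section fixr.
Variables (r : R) (r1 : r < 1).
Let A := closed_disc r.

Lemma normc_sqr_le (x : C) : A x -> normc x ^+ 2 <= r ^+ 2.
Proof.
rewrite /A /closed_disc /= => xr; have x0 := normc_ge0 x.
by rewrite lerXn2r ?nnegrE// (le_trans x0).
Qed.

Lemma cbmeas_id_closed_disc : cbmeas A id.
Proof.
have [h1 h2] := @cbmeas_id R.
by split; [apply: bmeas_sub h1|apply: bmeas_sub h2]; exact: closed_disc_sub.
Qed.

Lemma bmeas_kdiag : bmeas A kdiag.
Proof.
have [->|/set0P[a Aa]] := eqVneq A set0.
  split; last by exists 0.
  apply: ge0_measurable_funV; first by move=> x; rewrite sqr_ge0.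
  by apply: (bmeasX (D := disc R) 2 _).1; apply: bmeasB; [exact: bmeas_cst|exact:
    bmeas_normc_sqr (@cbmeas_id R)].
have r0 : 0 <= r := le_trans (normc_ge0 a) Aa.
have r2 : 0 < 1 - r ^+ 2 by rewrite subr_gt0 exprn_ilt1.
apply: (@bmeasV _ _ _ _ ((1 - r ^+ 2) ^+ 2)).
- by rewrite exprn_gt0.
- by move=> x; rewrite sqr_ge0.
- by move=> x /normc_sqr_le xr; rewrite lerXn2r ?nnegrE ?(ltW r2)//; lra.
- by apply: (bmeasX (D := disc R) 2 _).1; apply: bmeasB; [exact: bmeas_cst|exact:
  bmeas_normc_sqr (@cbmeas_id R)].
Qed.

Lemma cbmeas_fst : cbmeas (A `*` A) (fun p : C * C => p.1).
Proof.
have [[m1 [M1 h1]] [m2 [M2 h2]]] := cbmeas_id_closed_disc.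
split; split; [exact: (measurableT_comp m1 measurable_fst)|by exists M1 => x [/h1]|
  exact: (measurableT_comp m2 measurable_fst)|by exists M2 => x [/h2]].
Qed.

Lemma cbmeas_snd : cbmeas (A `*` A) (fun p : C * C => p.2).
Proof.
have [[m1 [M1 h1]] [m2 [M2 h2]]] := cbmeas_id_closed_disc.
split; split; [exact: (measurableT_comp m1 measurable_snd)|by exists M1 => x [_ /h1]|
  exact: (measurableT_comp m2 measurable_snd)|by exists M2 => x [_ /h2]].
Qed.

Lemma cbmeas_one_subJ2 : cbmeas (A `*` A) (fun p : C * C => 1 - p.1 * conjc p.2).
Proof.
apply: cbmeasB; first exact: cbmeas_cst.
by apply: cbmeasM; [exact: cbmeas_fst|apply: cbmeas_conj; exact: cbmeas_snd].
Qed.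

Lemma one_subJ_ge (x y : C) : A x -> A y -> 1 - r <= normc (1 - x * conjc y).
Proof.
move=> Ax Ay; apply: one_sub_ge; apply: normc_mulJ_le => //.
exact: closed_disc_sub Ay.
Qed.

Lemma bmeas_ksqr : bmeas (A `*` A) (fun p : C * C => ksqr p.1 p.2).
Proof.
have d0 : 0 < 1 - r by rewrite subr_gt0.
apply: (@bmeasV _ _ _ _ ((1 - r) ^+ 4)).
- by rewrite exprn_gt0.
- by move=> p; rewrite exprn_ge0// normc_ge0.
- by move=> p [A1 A2]; rewrite lerXn2r ?nnegrE ?normc_ge0 ?(ltW d0)//; exact: one_subJ_ge.
- under eq_fun do rewrite (exprM _ 2 2).
  exact: (bmeasX 2 (bmeas_normc_sqr cbmeas_one_subJ2)).1.
Qed.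

(** This is the Cauchy-Schwarz inequality for the kernel, and follows here from
    [normc (1 - x * conjc y) ^+ 2 =
     (1 - normc x ^+ 2) * (1 - normc y ^+ 2) + normc (x - y) ^+ 2]. *)
Lemma ksqr_le (x y : C) : normc x < 1 -> normc y < 1 -> ksqr x y <= kdiag x * kdiag y.
Proof.
move=> x1 y1; rewrite /ksqr /kdiag -invfM -exprMn (exprM _ 2 2).
have hx : 0 < 1 - normc x ^+ 2 by rewrite subr_gt0 exprn_ilt1 ?normc_ge0.
have hy : 0 < 1 - normc y ^+ 2 by rewrite subr_gt0 exprn_ilt1 ?normc_ge0.
have h : (1 - normc x ^+ 2) * (1 - normc y ^+ 2) <= normc (1 - x * conjc y) ^+ 2.
  rewrite !sqr_normcE; case: x y {x1 y1 hx hy} => a b [c d] /=.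
  have : 0 <= (a - c) ^+ 2 + (b - d) ^+ 2 by rewrite addr_ge0 ?sqr_ge0.
  by lra.
have h0 := mulr_gt0 hx hy.
have h1 := lt_le_trans h0 h.
by rewrite lef_pV2 ?posrE ?(exprn_gt0 2 h0) ?(exprn_gt0 2 h1)// lerXn2r ?nnegrE ?(ltW
  h0) ?(ltW h1).
Qed.

End fixr.
End Kernels.

(** * Second moments of linear statistics *)

Section SecondMoment.
Context {R : realType}.
Local Notation C := R[i].
Local Notation normc := (@Normc.normc R).
Variables (P : probability (Conf R) R)
  (hP : determinantal_process P bergman_kernel).
Variables (r : R) (r1 : r < 1).
Let A := closed_disc r.
Local Notation nu := (@disc_area R).

Definition smeas (u : C -> R) := bmeas setT u /\ supported r u.

Lemma smeas_out u : smeas u -> forall x, ~ A x -> u x = 0.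
Proof. by move=> [_ su] x /negP; rewrite /A /closed_disc /= -ltNge => /su. Qed.

Lemma smeasM u v : smeas u -> smeas v -> smeas (fun x => u x * v x).
Proof.
by move=> [bu su] [bv _]; split; [exact: bmeasM|move=> x /su ->; rewrite mul0r].
Qed.

Lemma smeas_kdiag u : smeas u -> bmeas setT (fun x => u x * kdiag x).
Proof. by move=> bu; apply: bmeas_mulr_supp (smeas_out bu) (bmeas_kdiag r1); case: bu. Qed.

Lemma bmeas_comp d1 d2 (T1 : measurableType d1) (T2 : measurableType d2) (f : T1 ->
  T2) (g : T2 -> R) :
  measurable_fun setT f -> bmeas setT g -> bmeas setT (fun x => g (f x)).
Proof.
by move=> mf [mg [M hM]]; split; [exact: measurableT_comp mg mf|exists M => x _; exact: hM].
Qed.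

Lemma bmeas_pair (u v : C -> R) : bmeas setT u -> bmeas setT v ->
  bmeas setT (fun p : C * C => u p.1 * v p.2).
Proof.
by move=> bu bv; apply: bmeasM; [exact: bmeas_comp bu|exact: bmeas_comp bv].
Qed.

Lemma smeas_pair_ksqr u v : smeas u -> smeas v ->
  bmeas setT (fun p : C * C => u p.1 * v p.2 * ksqr p.1 p.2).
Proof.
move=> bu bv; apply: bmeas_mulr_supp (bmeas_ksqr r1); first by apply: bmeas_pair;
  [case: bu|case: bv].
move=> [x y] /= nxy; have [Ax|/(smeas_out bu) ->] := pselect (A x); last by rewrite mul0r.
have [Ay|/(smeas_out bv) ->] := pselect (A y); last by rewrite mulr0.
by exfalso; apply: nxy.
Qed.

Definition Edisc (u : C -> R) : R := \int[nu]_x u x.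
Definition Edisc2 (F : C * C -> R) : R := \int[(nu \x nu)%E]_p F p.

Lemma disc_area2_fin : ((nu \x nu)%E setT < +oo)%E.
Proof.
rewrite -setXTT product_measure1E//.
by rewrite (etrans (congr2 (fun a b => (a * b)%E) (@disc_area_setT R) (@disc_area_setT R))
  (mul1e _)) ltry.
Qed.

Lemma disc_area_fin : (nu [set: C] < +oo)%E.
Proof. by rewrite disc_area_setT ltry. Qed.

Lemma Edisc2_prod (u v : C -> R) : bmeas setT u -> bmeas setT v ->
  Edisc2 (fun p => u p.1 * v p.2) = Edisc u * Edisc v.
Proof.
move=> bu bv; have bp := bmeas_pair bu bv.
have := bmeas_integrable measurableT disc_area2_fin bp => ip.
apply: EFin_inj; rewrite /Edisc2 -bmeas_RintegralE//; last exact: disc_area2_fin.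
rewrite -[LHS](integral12_prod_meas1 ip) /fubini_F /=.
under eq_integral => x _.
  rewrite bmeas_RintegralE; [|exact: measurableT|exact: disc_area_fin|by apply: bmeasM => //;
    exact: bmeas_cst].
  rewrite bmeas_RintegralZl; [|exact: measurableT|exact: disc_area_fin|by []].
  rewrite -/(Edisc v) mulrC; over.
rewrite bmeas_RintegralE; [|exact: measurableT|exact: disc_area_fin|by apply: bmeasM => //;
  exact: bmeas_cst].
by rewrite bmeas_RintegralZl//; [rewrite mulrC|exact: disc_area_fin].
Qed.

Local Notation T u := (fun X : Conf R => conf_sum X u).

Lemma mean_stat u : smeas u -> (forall x, 0 <= u x) ->
  (\int[P]_X (T u X)%:E = (Edisc (fun x => u x * kdiag x))%:E)%E.
Proof.
move=> bu u0; have [[mu _] su] := bu.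
have bk := smeas_kdiag bu.
have mphi : measurable_fun setT (fun t : 1.-tuple C => (u (tnth t ord0))%:E).
  by apply/measurable_EFinP; apply: measurableT_comp mu _; exact: measurable_tnth.
have h := hP.2 1%N isT _ mphi (fun t => _ : (0 <= (u (tnth t ord0))%:E)%E).
under eq_integral do rewrite -(distinct_sum1 r1)//.
rewrite h => [|t]; last by rewrite lee_fin.
rewrite /disc_integral.
under eq_integral do rewrite det_bergman1 -EFinM.
rewrite /Edisc -(bmeas_RintegralE measurableT disc_area_fin bk).
apply: ge0_integral_disc_area.
- by apply/measurable_EFinP; case: bk.
- by move=> x; rewrite lee_fin mulr_ge0// invr_ge0 sqr_ge0.
Qed.

(** The density of the second correlation function, tested against [u] and [v]. *)
Definition pair_density (u v : C -> R) (p : C * C) : R :=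
  (u p.1 * kdiag p.1) * (v p.2 * kdiag p.2) - u p.1 * v p.2 * ksqr p.1 p.2.

Lemma bmeas_pair_density u v : smeas u -> smeas v -> bmeas setT (pair_density u v).
Proof.
move=> bu bv; apply: bmeasB; last exact: smeas_pair_ksqr.
exact: (bmeas_pair (smeas_kdiag bu) (smeas_kdiag bv)).
Qed.

Lemma pair_density_ge0 u v p : smeas u -> smeas v -> (forall x, 0 <= u x) ->
  (forall x, 0 <= v x) -> 0 <= pair_density u v p.
Proof.
move=> bu bv u0 v0; case: p => x y; rewrite /pair_density /=.
have -> : u x * kdiag x * (v y * kdiag y) - u x * v y * ksqr x y =
  u x * v y * (kdiag x * kdiag y - ksqr x y) by ring.
have [Ax|/(smeas_out bu) ->] := pselect (A x); last by rewrite !mul0r.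
have [Ay|/(smeas_out bv) ->] := pselect (A y); last by rewrite mulr0 mul0r.
apply: mulr_ge0; first exact: mulr_ge0.
by rewrite subr_ge0 ksqr_le//; apply: le_lt_trans r1.
Qed.

Lemma mean_distinct_pairs u v : smeas u -> smeas v -> (forall x, 0 <= u x) ->
  (forall x, 0 <= v x) ->
  (\int[P]_X (conf_sum X u * conf_sum X v - conf_sum X (fun x => (u x * v x)%R))%:E =
   (Edisc2 (pair_density u v))%:E)%E.
Proof.
move=> bu bv u0 v0; have [[mu _] su] := bu; have [[mv _] sv] := bv.
have bF := bmeas_pair_density bu bv.
pose phi (t : 2.-tuple C) := (u (tnth t ord0) * v (tnth t (lift ord0 ord0)))%:E.
have mphi : measurable_fun setT phi.
  apply/measurable_EFinP; apply: measurable_funM.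
    by apply: measurableT_comp mu _; exact: measurable_tnth.
  by apply: measurableT_comp mv _; exact: measurable_tnth.
have phi0 t : (0 <= phi t)%E by rewrite lee_fin mulr_ge0.
have h := hP.2 2%N isT _ mphi phi0.
under eq_integral do rewrite -(distinct_sum2 r1)//.
rewrite [LHS]h /disc_integral.
have mF : measurable_fun setT (EFin \o pair_density u v).
  by apply/measurable_EFinP; case: bF.
have F0 p : (0 <= (EFin \o pair_density u v) p)%E by rewrite lee_fin pair_density_ge0.
transitivity (\int[area R]_(x in disc R) fubini_F nu (EFin \o pair_density u v) x)%E.
  apply: eq_integral => x _; rewrite /fubini_F.
  rewrite -ge0_integral_disc_area//.
    apply: eq_integral => y _; rewrite det_bergman2 -EFinM; congr EFin.
    rewrite /pair_density !(tnth_nth 0) /=.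
    by move: (kdiag x) (kdiag y) (ksqr x y) => a b c; ring.
  by apply: (measurableT_comp mF); exact: measurable_pair1.
rewrite /Edisc2 -(bmeas_RintegralE measurableT disc_area2_fin bF).
rewrite (fubini_tonelli1 _ mF F0).
apply: ge0_integral_disc_area.
  exact: measurable_fun_fubini_tonelli_F.
by move=> x; apply: integral_ge0 => y _.
Qed.

Lemma measurable_stat u : smeas u -> (forall x, 0 <= u x) -> measurable_fun setT (T u).
Proof. by move=> [[mu _] su] u0; exact: measurable_conf_sum_ge0 r1 _ mu u0 su. Qed.

(** The mean of the linear statistic of [u]. *)
Definition Ediag u := Edisc (fun x => u x * kdiag x).
(** The negative part of the covariance of a determinantal process. *)
Definition Eksqr u v := Edisc2 (fun p => u p.1 * v p.2 * ksqr p.1 p.2).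

(** The pairs of distinct points contribute through the second correlation function,
    the diagonal pairs through the first one. *)
Lemma mean_stat_prod u v : smeas u -> smeas v -> (forall x, 0 <= u x) ->
  (forall x, 0 <= v x) ->
  (\int[P]_X (conf_sum X u * conf_sum X v)%:E =
   (Ediag u * Ediag v - Eksqr u v + Ediag (fun x => u x * v x)%R)%:E)%E.
Proof.
move=> bu bv u0 v0; have buv := smeasM bu bv.
have uv0 x : 0 <= u x * v x by rewrite mulr_ge0.
have [[[_ _] su] [[_ _] sv]] := (bu, bv).
have mu := measurable_stat bu u0; have mv := measurable_stat bv v0;
  have muv := measurable_stat buv uv0.
transitivity (\int[P]_X ((conf_sum X u * conf_sum X v - conf_sum X (fun x => (u x * v x)%R))%:E
   + (conf_sum X (fun x => (u x * v x)%R))%:E))%E.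
  by apply: eq_integral => X _; rewrite -EFinD subrK.
rewrite ge0_integralD//; last 4 first.
- move=> X _; rewrite -(distinct_sum2 r1 X u0 v0 su sv); apply: esum_ge0 => t _.
  by rewrite lee_fin mulr_ge0.
- apply/measurable_EFinP; apply: measurable_funB muv; exact: measurable_funM.
- by move=> X _; rewrite lee_fin conf_sum_ge0.
- exact/measurable_EFinP.
rewrite mean_distinct_pairs// mean_stat// -EFinD; congr (EFin (_ + _)).
rewrite /Edisc2 bmeas_RintegralB; [|exact: measurableT|exact: disc_area2_fin|exact:
  bmeas_pair (smeas_kdiag bu) (smeas_kdiag bv)|exact: smeas_pair_ksqr].
by congr (_ - _); exact: Edisc2_prod (smeas_kdiag bu) (smeas_kdiag bv).
Qed.

Definition P_integrable (f : Conf R -> R) := P.-integrable setT (EFin \o f).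

Lemma P_integrableD f g : P_integrable f -> P_integrable g ->
  P_integrable (fun X => f X + g X).
Proof. by move=> hf hg; exact: (integrableD measurableT hf hg). Qed.

Lemma P_integrableZ c f : P_integrable f -> P_integrable (fun X => c * f X).
Proof. by move=> hf; exact: (integrableZl measurableT c hf). Qed.

Lemma P_integrable_stat u : smeas u -> (forall x, 0 <= u x) -> P_integrable (T u).
Proof.
move=> bu u0; apply/integrableP; split; first by apply/measurable_EFinP;
  exact: measurable_stat.
rewrite (eq_integral (fun X : Conf R => (conf_sum X u)%:E)); first by rewrite mean_stat// ltry.
by move=> X _; rewrite gee0_abs// lee_fin; exact: conf_sum_ge0.
Qed.

Lemma P_integrable_stat_prod u v : smeas u -> smeas v -> (forall x, 0 <= u x) ->
  (forall x, 0 <= v x) ->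
  P_integrable (fun X => conf_sum X u * conf_sum X v).
Proof.
move=> bu bv u0 v0; apply/integrableP; split.
  by apply/measurable_EFinP; apply: measurable_funM; exact: measurable_stat.
rewrite (eq_integral (fun X : Conf R => (conf_sum X u * conf_sum X v)%:E)).
  by rewrite mean_stat_prod// ltry.
by move=> X _; rewrite gee0_abs// lee_fin; apply: mulr_ge0; exact: conf_sum_ge0.
Qed.

Definition EP (f : Conf R -> R) : R := \int[P]_X f X.

Lemma EPD f g : P_integrable f -> P_integrable g -> EP (fun X => f X + g X) = EP f + EP g.
Proof. by move=> hf hg; rewrite /EP RintegralD. Qed.

Lemma EPZ c f : P_integrable f -> EP (fun X => c * f X) = c * EP f.
Proof. by move=> hf; rewrite /EP RintegralZl. Qed.

Lemma smeas_max (u : C -> R) : smeas u -> smeas (fun x => Num.max (u x) 0).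
Proof.
move=> [[mu [M hM]] su]; split; last by move=> x /su ->; rewrite maxxx.
split; first by apply: measurable_maxr => //; exact: measurable_cst.
exists M => x _; apply: le_trans (hM x Logic.I).
by rewrite ger0_norm ?le_max ?lexx ?orbT// ge_max ler_norm normr_ge0.
Qed.

Lemma smeasN (u : C -> R) : smeas u -> smeas (fun x => - u x).
Proof. by move=> [bu su]; split; [exact: bmeasN|move=> x /su ->; rewrite oppr0]. Qed.

Lemma EdiagB u v : smeas u -> smeas v -> Ediag (fun x => u x - v x) = Ediag u - Ediag v.
Proof.
move=> bu bv; rewrite /Ediag /Edisc -bmeas_RintegralB; [|exact: measurableT|exact:
  disc_area_fin|exact: smeas_kdiag|exact: smeas_kdiag].
by apply: eq_Rintegral => x _; rewrite mulrBl.
Qed.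

Lemma smeasB u v : smeas u -> smeas v -> smeas (fun x => u x - v x).
Proof.
move=> [bu su] [bv sv]; split; first exact: bmeasB.
by move=> x rx; rewrite su// sv// subr0.
Qed.

Lemma EksqrBl u v w : smeas u -> smeas v -> smeas w ->
  Eksqr (fun x => u x - v x) w = Eksqr u w - Eksqr v w.
Proof.
move=> bu bv bw; rewrite /Eksqr /Edisc2 -bmeas_RintegralB; [|exact: measurableT|exact:
  disc_area2_fin|exact: smeas_pair_ksqr|exact: smeas_pair_ksqr].
by apply: eq_Rintegral => x _; rewrite !mulrBl.
Qed.

Lemma EksqrBr u v w : smeas u -> smeas v -> smeas w ->
  Eksqr w (fun x => u x - v x) = Eksqr w u - Eksqr w v.
Proof.
move=> bu bv bw; rewrite /Eksqr /Edisc2 -bmeas_RintegralB; [|exact: measurableT|exact: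
  disc_area2_fin|exact: smeas_pair_ksqr|exact: smeas_pair_ksqr].
by apply: eq_Rintegral => x _; rewrite mulrBr mulrBl.
Qed.

(** The right-hand side is the second moment about [c], which is at least the
    variance [Ediag (u ^+ 2) - Eksqr u u]. Correlation functions only integrate
    nonnegative functions, so [u] is split into its positive and negative parts and
    the second moment expanded bilinearly. *)
Lemma second_moment_ge u c : smeas u ->
  measurable_fun setT (T u) /\
  ((Ediag (fun x => u x * u x)%R - Eksqr u u)%:E <= \int[P]_X ((conf_sum X u - c) ^+ 2)%:E)%E.
Proof.
move=> bu; pose p x := Num.max (u x) 0; pose n x := Num.max (- u x) 0.
have bp : smeas p by exact: smeas_max.
have bn : smeas n by exact: smeas_max (smeasN bu).
have p0 x : 0 <= p x by rewrite le_max lexx orbT.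
have n0 x : 0 <= n x by rewrite le_max lexx orbT.
have upn : u = fun x => p x - n x.
  by apply/funext => x; rewrite /p /n; case: (lerP (u x) 0) => h;
    case: (lerP (- u x) 0) => h'; lra.
have Tpn X : conf_sum X u = conf_sum X p - conf_sum X n.
  by rewrite [in LHS]upn (conf_sumB r1)//; [case: bp|case: bn].
split.
  rewrite (_ : (fun X => _) = (fun X : Conf R => conf_sum X p - conf_sum X n)); last first.
    by apply/funext => X; rewrite Tpn.
  by apply: measurable_funB; exact: measurable_stat.
pose S (a b : C -> R) (X : Conf R) := conf_sum X a * conf_sum X b.
have iS a b : smeas a -> smeas b -> (forall x, 0 <= a x) -> (forall x, 0 <= b x) ->
  P_integrable (S a b) by exact: P_integrable_stat_prod.
have ES a b : smeas a -> smeas b -> (forall x, 0 <= a x) -> (forall x, 0 <= b x) ->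
   EP (S a b) = Ediag a * Ediag b - Eksqr a b + Ediag (fun x => a x * b x).
  by move=> ba bb a0 b0; rewrite /EP /Rintegral mean_stat_prod.
have ET a : smeas a -> (forall x, 0 <= a x) -> EP (T a) = Ediag a.
  by move=> ba a0; rewrite /EP /Rintegral mean_stat.
pose G (X : Conf R) := S p p X + (S n n X + (-1 * S p n X + (-1 * S n p X +
   ((- (2%:R * c)) * conf_sum X p + ((2%:R * c) * conf_sum X n + c ^+ 2))))).
have icst : P_integrable (fun=> c ^+ 2) by exact: finite_measure_integrable_cst.
have i6 : P_integrable (fun X => (2%:R * c) * conf_sum X n + c ^+ 2).
  by apply: P_integrableD => //; apply: P_integrableZ; exact: P_integrable_stat.
have i5 : P_integrable (fun X => (- (2%:R * c)) * conf_sum X p + ((2%:R * c) * conf_sum X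
  n + c ^+ 2)).
  by apply: P_integrableD => //; apply: P_integrableZ; exact: P_integrable_stat.
have i4 := P_integrableD (P_integrableZ (-1) (iS n p bn bp n0 p0)) i5.
have i3 := P_integrableD (P_integrableZ (-1) (iS p n bp bn p0 n0)) i4.
have i2 := P_integrableD (iS n n bn bn n0 n0) i3.
have i1 : P_integrable G := P_integrableD (iS p p bp bp p0 p0) i2.
have -> : (\int[P]_X ((conf_sum X u - c) ^+ 2)%:E = (EP G)%:E)%E.
  rewrite /EP /Rintegral fineK; last exact: integrable_fin_num i1.
  by apply: eq_integral => X _; congr EFin; rewrite Tpn /G /S; ring.
have EG : EP G = (Ediag (fun x => u x * u x) - Eksqr u u) + (Ediag p - Ediag n - c) ^+ 2.
  rewrite /G EPD//; last exact: iS.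
  rewrite EPD//; last exact: iS.
  rewrite EPD//; last by apply: P_integrableZ; exact: iS.
  rewrite EPD//; last by apply: P_integrableZ; exact: iS.
  rewrite EPD//; last by apply: P_integrableZ; exact: P_integrable_stat.
  rewrite EPD//; last by apply: P_integrableZ; exact: P_integrable_stat.
  have -> : EP (fun=> c ^+ 2) = c ^+ 2.
    rewrite /EP Rintegral_cst//.
    exact: etrans (congr1 (fun y => c ^+ 2 * fine y) (probability_setT P)) (mulr1 _).
  rewrite !EPZ; do ?[exact: iS|exact: P_integrable_stat].
  rewrite !ES// !ET//.
  have -> : Eksqr u u = Eksqr p p - Eksqr p n - (Eksqr n p - Eksqr n n).
    by rewrite upn EksqrBl// ?EksqrBr//; exact: smeasB.
  have -> : Ediag (fun x => u x * u x) = Ediag (fun x => p x * p x) - Ediag (fun x =>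
    p x * n x)
     - (Ediag (fun x => n x * p x) - Ediag (fun x => n x * n x)).
    rewrite -!EdiagB; do ?[exact: smeasM|exact: smeasB].
      by congr Ediag; apply/funext => x; rewrite upn; ring.
    - by apply: smeasB; exact: smeasM.
    - by apply: smeasB; exact: smeasM.
  by ring.
by rewrite lee_fin EG lerDl sqr_ge0.
Qed.

End SecondMoment.

(** * The sum of the variances over the basis *)

Section SpectralBound.
Context {R : realType}.
Local Notation C := R[i].
Local Notation normc := (@Normc.normc R).
Local Notation Re := (@complex.Re R).
Local Notation Im := (@complex.Im R).
Local Notation nu := (@disc_area R).

(** The orthonormal basis of the Bergman space. *)
Definition onb (k : nat) (x : C) : C := (Num.sqrt k.+1%:R)%:C * x ^+ k.

(** The truncated Bergman kernel is the partial sum of the basis expansion; real and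
    imaginary parts are kept apart because the second moments are those of real
    statistics. *)
Lemma onb_kernel N (x y : C) :
  \sum_(k < N) (Re (onb k x) * Re (onb k y) + Im (onb k x) * Im (onb k y)) =
  Re (Ksum N (x * conjc y)).
Proof.
rewrite /Ksum Re_sum; apply: eq_bigr => k _.
have <- : onb k x * conjc (onb k y) = k.+1%:R * (x * conjc y) ^+ k.
  have conj_ek : conjc (onb k y) = (Num.sqrt k.+1%:R)%:C * conjc y ^+ k.
    by rewrite -(conjc_real (Num.sqrt _)) -rmorphXn -rmorphM.
  rewrite conj_ek /onb exprMn mulrACA; congr (_ * _).
  by rewrite -rmorphM -expr2 sqr_sqrtr ?ler0n// rmorph_nat.
by rewrite ReM; case: (onb k y) => a b /=; rewrite mulrN opprK.
Qed.

Variables (r : R) (r0 : 0 <= r) (r1 : r < 1) (N : nat) (hN : tail_le r N).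
Let A := closed_disc r.
Variables (w : C -> R) (bw : smeas r w) (w0 : forall x, 0 <= w x).

Definition re_part k x := w x * Re (onb k x).
Definition im_part k x := w x * Im (onb k x).

Lemma cbmeas_onb k : cbmeas A (onb k).
Proof. by apply: cbmeasM; [exact: cbmeas_cst|apply: cbmeasX;
  exact: cbmeas_id_closed_disc]. Qed.

Lemma smeas_mul (u g : C -> R) : smeas r u -> bmeas A g -> smeas r (fun x => u x * g x).
Proof.
move=> bu bg; split; last by move=> x rx; rewrite (proj2 bu)// mul0r.
by apply: bmeas_mulr_supp (smeas_out bu) bg; case: bu.
Qed.

Lemma smeas_re_part k : smeas r (re_part k).
Proof. by apply: smeas_mul => //; case: (cbmeas_onb k). Qed.

Lemma smeas_im_part k : smeas r (im_part k).
Proof. by apply: smeas_mul => //; case: (cbmeas_onb k). Qed.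

Let h x := w x * kdiag x.

Let bh : smeas r h.
Proof. by apply: smeas_mul => //; exact: bmeas_kdiag. Qed.

Let h0 x : 0 <= h x.
Proof. by rewrite mulr_ge0// invr_ge0 sqr_ge0. Qed.

(** Cauchy-Schwarz on a probability space, from the square of [h - 1]. *)
Lemma Edisc_sqr_ge1 : Ediag w = 1 -> 1 <= Edisc (fun x => h x ^+ 2).
Proof.
move=> hw; have bh1 : bmeas setT h by case: bh.
have b2 : bmeas setT (fun x => h x ^+ 2) by exact: bmeasX.
have : 0 <= Edisc (fun x => h x ^+ 2 - (2%:R * h x - 1)).
  by apply: Rintegral_ge0 => x _; have := sqr_ge0 (h x - 1); lra.
have bl : bmeas setT (fun x => 2%:R * h x) by apply: bmeasM => //; exact: bmeas_cst.
have fin := @disc_area_fin R.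
rewrite /Edisc bmeas_RintegralB//; last by apply: bmeasB => //; exact: bmeas_cst.
rewrite bmeas_RintegralB//; last exact: bmeas_cst.
rewrite bmeas_RintegralZl// -/(Edisc h) (_ : Edisc h = 1)//.
have -> : \int[nu]_(x in setT) (1 : R) = 1.
  rewrite Rintegral_cst//.
  exact: etrans (congr1 (fun y => 1 * fine y) (@disc_area_setT R)) (mulr1 _).
by lra.
Qed.

(** [h p.1 ^+ 2] times the kernel of the Schur test, cut off in the second variable
    to the closed disc that supports [w], which makes it bounded. *)
Let majorant (p : C * C) : R :=
  h p.1 ^+ 2 * (1 - normc p.1 ^+ 2) ^+ 2 * (\1_A p.2 * schur_fun p.1 p.2).

Let smeas_indicA : smeas r (\1_A : C -> R).
Proof.
split; last first.
  move=> x rx; rewrite indicE memNset// /A /closed_disc /= => xr.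
  by move: rx; rewrite ltNge xr.
split; first by apply: measurable_indic; exact: measurable_closed_disc.
by exists 1 => x _; rewrite indicE; case: (x \in A); rewrite ?normr0 ?normr1 ?ler01.
Qed.

Lemma bmeas_sqr_one_sub : bmeas A (fun x : C => (1 - normc x ^+ 2) ^+ 2).
Proof.
by apply: bmeasX; apply: bmeasB; [exact: bmeas_cst|apply: (bmeas_normc_sqr (F := id));
  exact: cbmeas_id_closed_disc].
Qed.

Lemma bmeas_inv6 : bmeas (A `*` A) (fun p : C * C => (normc (1 - p.1 * conjc p.2) ^+ 6)^-1).
Proof.
have d0 : 0 < 1 - r by rewrite subr_gt0.
apply: (@bmeasV _ _ _ _ _ ((1 - r) ^+ 6)).
- by rewrite exprn_gt0.
- by move=> p; rewrite exprn_ge0// normc_ge0.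
- by move=> p [A1 A2]; rewrite lerXn2r ?nnegrE ?normc_ge0 ?(ltW d0)//; exact: one_subJ_ge.
- under eq_fun do rewrite (exprM _ 2 3).
  exact: (bmeasX 3 (bmeas_normc_sqr (cbmeas_one_subJ2 r1))).1.
Qed.

Lemma smeas_pair (u v : C -> R) (G : C * C -> R) : smeas r u -> smeas r v ->
  bmeas (A `*` A) G ->
  bmeas setT (fun p : C * C => u p.1 * v p.2 * G p).
Proof.
move=> bu bv bG; apply: bmeas_mulr_supp bG; first by apply: bmeas_pair; [case: bu|case: bv].
move=> [x y] /= nxy; have [Ax|/(smeas_out bu) ->] := pselect (A x); last by rewrite mul0r.
have [Ay|/(smeas_out bv) ->] := pselect (A y); last by rewrite mulr0.
by exfalso; apply: nxy.
Qed.

Let bmeas_majorant : bmeas setT majorant.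
Proof.
have b1 : smeas r (fun x => h x ^+ 2 * (1 - normc x ^+ 2) ^+ 2).
  by under eq_fun do rewrite expr2; apply: smeas_mul bmeas_sqr_one_sub; exact: smeasM.
have b2 : smeas r (fun y => \1_A y * (1 - normc y ^+ 2) ^+ 2) := smeas_mul smeas_indicA
  bmeas_sqr_one_sub.
apply: bmeas_ext (smeas_pair b1 b2 bmeas_inv6) => p.
by rewrite /majorant /schur_fun; ring.
Qed.

Let majorant_ge0 p : 0 <= majorant p.
Proof.
apply: mulr_ge0; first by apply: mulr_ge0; exact: sqr_ge0.
by apply: mulr_ge0; [rewrite indicE ler0n|exact: schur_ge0].
Qed.

Lemma majorant_slice x : (\int[nu]_y (majorant (x, y))%:E <= (10%:R / 19%:R * h x ^+ 2)%:E)%E.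
Proof.
have [Ax|nAx] := pselect (A x); last first.
  rewrite /majorant /= (smeas_out bh nAx) expr0n /= mulr0.
  by under eq_integral do rewrite !mul0r; rewrite integral0.
have mS := measurable_schur_fun x; have bS := bmeas_schur_fun r1 Ax.
pose c := h x ^+ 2 * (1 - normc x ^+ 2) ^+ 2.
have c0 : 0 <= c by rewrite mulr_ge0 ?sqr_ge0.
apply: (@le_trans _ _ (\int[nu]_y (c * schur_fun x y)%:E)%E).
  apply: ge0_le_integral => //.
  - by move=> y _; rewrite lee_fin majorant_ge0.
  - apply/measurable_EFinP; apply: (measurableT_comp bmeas_majorant.1).
    exact: measurable_pair1.
  - by apply/measurable_EFinP; apply: measurable_funM => //; exact: measurable_cst.
  - move=> y _; rewrite lee_fin /majorant /= -/c; apply: ler_wpM2l => //.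
    apply: ler_piMl; first exact: schur_ge0.
    by rewrite indicE; case: (y \in A); rewrite ?lexx ?ler01.
rewrite -ge0_integral_disc_area; last 2 first.
- by apply/measurable_EFinP; apply: measurable_funM => //; exact: measurable_cst.
- by move=> y; rewrite lee_fin mulr_ge0 ?schur_ge0.
have mD := @measurable_disc R; have fD := @area_disc_fin R.
rewrite bmeas_RintegralE//; last by apply: bmeasM => //; exact: bmeas_cst.
rewrite bmeas_RintegralZl// lee_fin.
apply: (@le_trans _ _ (c * (10%:R / 19%:R / (1 - normc x ^+ 2) ^+ 2))).
  by rewrite ler_wpM2l//; exact: schur_bound r1 hN Ax.
have d0 : 0 < 1 - normc x ^+ 2.
  by rewrite subr_gt0 exprn_ilt1 ?normc_ge0// (le_lt_trans Ax).
rewrite /c le_eqVlt; apply/orP; left; apply/eqP.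
move: (h x) (1 - normc x ^+ 2) d0 => a b b0; field.
by rewrite gt_eqF.
Qed.

Let Eh2 := Edisc (fun x => h x ^+ 2).

Lemma majorant_bound : Edisc2 majorant <= 10%:R / 19%:R * Eh2.
Proof.
have bh2 : bmeas setT (fun x => h x ^+ 2) by apply: bmeasX; case: bh.
have fin := @disc_area_fin R.
rewrite -lee_fin -(bmeas_RintegralE measurableT (@disc_area2_fin R) bmeas_majorant).
rewrite /Eh2 /Edisc -bmeas_RintegralZl// -bmeas_RintegralE//; last by apply: bmeasM => //;
  exact: bmeas_cst.
have mF : measurable_fun setT (EFin \o majorant) by apply/measurable_EFinP;
  case: bmeas_majorant.
have F0 p : (0 <= (EFin \o majorant) p)%E by rewrite lee_fin majorant_ge0.
rewrite (fubini_tonelli1 _ mF F0); apply: ge0_le_integral => //.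
- by move=> x _; apply: integral_ge0 => y _.
- exact: measurable_fun_fubini_tonelli_F.
- apply/measurable_EFinP; apply: measurable_funM; [exact: measurable_cst|by case: bh2].
- by move=> x _; exact: majorant_slice.
Qed.

Lemma majorant_swap_bound : Edisc2 (fun p => majorant (p.2, p.1)) <= 10%:R / 19%:R * Eh2.
Proof.
have mF : measurable_fun setT (EFin \o (fun p => majorant (p.2, p.1))).
  apply/measurable_EFinP; apply: (measurableT_comp bmeas_majorant.1).
  by apply/measurable_fun_pair; [exact: measurable_snd|exact: measurable_fst].
have mF1 : measurable_fun setT (EFin \o majorant) by apply/measurable_EFinP;
  case: bmeas_majorant.
have F0 p : (0 <= (EFin \o (fun p => majorant (p.2, p.1))) p)%E by rewrite lee_fin
  majorant_ge0.
have F01 p : (0 <= (EFin \o majorant) p)%E by rewrite lee_fin majorant_ge0.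
apply: le_trans majorant_bound.
rewrite /Edisc2 /Rintegral (fubini_tonelli1 _ mF1 F01) (fubini_tonelli2 _ mF F0).
exact: lexx.
Qed.

Lemma Re_Ksum_real (t : R) : Re (Ksum N t%:C) = Ksum N t.
Proof.
rewrite /Ksum Re_sum; apply: eq_bigr => k _.
by rewrite Re_natM -rmorphXn.
Qed.

Let diag_sum (x : C) : R := \sum_(k < N) (re_part k x * re_part k x + im_part k x * im_part k
  x).

Lemma diag_sum_ge x : 95%:R / 100%:R * h x ^+ 2 <= diag_sum x * kdiag x.
Proof.
have -> : diag_sum x = w x ^+ 2 * Ksum N (normc x ^+ 2).
  rewrite -Re_Ksum_real -mulc_conj -onb_kernel big_distrr /=.
  by apply: eq_bigr => k _; rewrite /re_part /im_part; ring.
have [Ax|nAx] := pselect (A x); last by rewrite /h (smeas_out bw nAx) !(mul0r, expr0n, mulr0).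
have x0 := normc_ge0 x.
have hx : 0 <= normc x ^+ 2 <= r.
  rewrite sqr_ge0 /=; apply: (le_trans (normc_sqr_le Ax)).
  by rewrite expr2 -[leRHS]mulr1 ler_wpM2l// ltW.
have := Ksum_diag_ge r0 r1 hN hx; rewrite -/(kdiag x) => hk.
have k0 : 0 <= kdiag x by rewrite invr_ge0 sqr_ge0.
rewrite /h; have := ler_wpM2l (mulr_ge0 (sqr_ge0 (w x)) k0) hk.
by move: (Ksum _ _) (kdiag x) (w x) => a b c; lra.
Qed.

Let off_sum (p : C * C) : R :=
  \sum_(k < N) (re_part k p.1 * re_part k p.2 * ksqr p.1 p.2 + im_part k p.1 * im_part k
    p.2 * ksqr p.1 p.2).

(** The truncated kernel times [ksqr] is at most [105 / 100] times the cube of the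
    modulus of the kernel; then [h x * h y <= (h x ^+ 2 + h y ^+ 2) / 2] makes each
    half depend on [h] through one variable only, ready for the Schur test. *)
Lemma off_sum_le p :
  off_sum p <= 105%:R / 200%:R * (majorant p + majorant (p.2, p.1)).
Proof.
case: p => x y; rewrite /off_sum /majorant /=.
have -> : \sum_(k < N) (re_part k x * re_part k y * ksqr x y + im_part k x * im_part k y *
  ksqr x y) =
    w x * w y * (Re (Ksum N (x * conjc y)) * ksqr x y).
  rewrite -onb_kernel big_distrl big_distrr /=.
  by apply: eq_bigr => k _; rewrite /re_part /im_part; ring.
have nn (a b : C) : 0 <= h a ^+ 2 * (1 - normc a ^+ 2) ^+ 2 * (\1_A b * schur_fun a b).
  exact: (majorant_ge0 (a, b)).
have rhs0 : 0 <= 105%:R / 200%:R * (h x ^+ 2 * (1 - normc x ^+ 2) ^+ 2 * (\1_A y * schur_fun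
  x y) +
    h y ^+ 2 * (1 - normc y ^+ 2) ^+ 2 * (\1_A x * schur_fun y x)).
  by rewrite mulr_ge0// ?addr_ge0.
have [Ax|nAx] := pselect (A x); last by rewrite (smeas_out bw nAx) !mul0r.
have [Ay|nAy] := pselect (A y); last by rewrite (smeas_out bw nAy) mulr0 mul0r.
move=> {rhs0}; rewrite !indicE !mem_set// !mul1r.
have ur : normc (x * conjc y) <= r.
  by apply: normc_mulJ_le => //; exact: closed_disc_sub Ay.
have hK := Ksum_le r1 hN ur.
have n0 := one_sub_gt0 r1 ur.
have hRe : Re (Ksum N (x * conjc y)) <= normc (Ksum N (x * conjc y)).
  apply: le_trans (ler_norm _) _; rewrite -lecR -normCE; exact: normc_ge_Re.
have sym : normc (1 - y * conjc x) = normc (1 - x * conjc y).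
  rewrite -normc_conj; congr normc.
  by rewrite rmorphB rmorph1 rmorphM /= conjcK mulrC.
have d a : A a -> 0 < 1 - normc a ^+ 2.
  by move=> Aa; rewrite subr_gt0 exprn_ilt1 ?normc_ge0// (le_lt_trans Aa).
have [dx dy] := (d x Ax, d y Ay).
have wh a : A a -> w a = h a * (1 - normc a ^+ 2) ^+ 2.
  by move=> /d da; rewrite /h /kdiag -mulrA mulVf ?mulr1// expf_neq0// gt_eqF.
rewrite /schur_fun sym (wh x Ax) (wh y Ay) /ksqr.
apply: (@le_trans _ _ (h x * (1 - normc x ^+ 2) ^+ 2 * (h y * (1 - normc y ^+ 2) ^+ 2) *
   (105%:R / 100%:R / normc (1 - x * conjc y) ^+ 2 * (normc (1 - x * conjc y) ^+ 4)^-1))).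
  apply: ler_wpM2l; first by apply: mulr_ge0; apply: mulr_ge0; rewrite ?h0 ?sqr_ge0.
  by apply: ler_wpM2r; [rewrite invr_ge0 exprn_ge0 ?(ltW n0)|exact: le_trans hRe hK].
have hh : 2%:R * (h x * h y) <= h x ^+ 2 + h y ^+ 2.
  by have := sqr_ge0 (h x - h y); lra.
have c0 : 0 <= 105%:R / 200%:R * ((1 - normc x ^+ 2) ^+ 2 * (1 - normc y ^+ 2) ^+ 2 /
    normc (1 - x * conjc y) ^+ 6).
  apply: mulr_ge0 => //; apply: mulr_ge0; first by apply: mulr_ge0; exact: sqr_ge0.
  by rewrite invr_ge0 exprn_ge0 ?(ltW n0).
have := ler_wpM2l c0 hh; move: n0.
move: (normc (1 - _)) (1 - normc x ^+ 2) (1 - normc y ^+ 2) (h x) (h y) => n a b s t n0 H.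
have nn0 : n != 0 by rewrite gt_eqF.
have -> : s * a ^+ 2 * (t * b ^+ 2) * (105%:R / 100%:R / n ^+ 2 * (n ^+ 4)^-1) =
    105%:R / 200%:R * (a ^+ 2 * b ^+ 2 / n ^+ 6) * (2%:R * (s * t)) by field.
have -> : 105%:R / 200%:R * (s ^+ 2 * a ^+ 2 * (b ^+ 2 / n ^+ 6) + t ^+ 2 * b ^+ 2 *
  (a ^+ 2 / n ^+ 6)) =
    105%:R / 200%:R * (a ^+ 2 * b ^+ 2 / n ^+ 6) * (s ^+ 2 + t ^+ 2) by field.
exact: H.
Qed.

(** The sum of the variances over the basis. The diagonal part is at least
    [95 / 100] and the negative part at most [105 / 200 * 2 * 10 / 19] times the integral
    of [h ^+ 2], which is at least [1]. *)
Lemma spectral_bound : Ediag w = 1 -> 39%:R / 100%:R <=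
  \sum_(k < N) ((Ediag (fun x => re_part k x * re_part k x) - Eksqr (re_part k) (re_part k)) +
                 (Ediag (fun x => im_part k x * im_part k x) - Eksqr (im_part k) (im_part k))).
Proof.
move=> hw; have fin := @disc_area_fin R; have fin2 := @disc_area2_fin R.
have bu2 k : bmeas setT (fun x => re_part k x * re_part k x * kdiag x).
  by apply: (smeas_kdiag r1); apply: smeasM; exact: smeas_re_part.
have bv2 k : bmeas setT (fun x => im_part k x * im_part k x * kdiag x).
  by apply: (smeas_kdiag r1); apply: smeasM; exact: smeas_im_part.
have bu3 k := smeas_pair_ksqr r1 (smeas_re_part k) (smeas_re_part k).
have bv3 k := smeas_pair_ksqr r1 (smeas_im_part k) (smeas_im_part k).
have bh2 : bmeas setT (fun x => h x ^+ 2) by apply: bmeasX; case: bh.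
have bF1s : bmeas setT (fun p => majorant (p.2, p.1)).
  by apply: bmeas_comp bmeas_majorant; apply/measurable_fun_pair;
    [exact: measurable_snd|exact: measurable_fst].
have D : \sum_(k < N) (Ediag (fun x => re_part k x * re_part k x) + Ediag (fun x =>
  im_part k x * im_part k x)) =
    Edisc (fun x => diag_sum x * kdiag x).
  rewrite /Ediag /Edisc; under eq_bigr => k _ do rewrite -bmeas_RintegralD//.
  rewrite -bmeas_Rintegral_sum//; last by move=> k; exact: bmeasD.
  apply: eq_Rintegral => x _; rewrite /diag_sum big_distrl /=.
  by apply: eq_bigr => k _; rewrite mulrDl.
have O : \sum_(k < N) (Eksqr (re_part k) (re_part k) + Eksqr (im_part k) (im_part k)) =
  Edisc2 off_sum.
  rewrite /Eksqr /Edisc2; under eq_bigr => k _ do rewrite -bmeas_RintegralD//.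
  by rewrite -bmeas_Rintegral_sum// => k; exact: bmeasD.
have bds : bmeas setT (fun x => diag_sum x * kdiag x).
  apply: (bmeas_ext (f := fun x => \sum_(k < N) (re_part k x * re_part k x * kdiag
    x + im_part k x * im_part k x * kdiag x))).
    by move=> x; rewrite /diag_sum big_distrl /=; apply: eq_bigr => k _; rewrite mulrDl.
  by apply: bmeas_sum => k; exact: bmeasD.
have bos : bmeas setT off_sum by apply: bmeas_sum => k; exact: bmeasD.
have hD : 95%:R / 100%:R * Eh2 <= Edisc (fun x => diag_sum x * kdiag x).
  rewrite /Eh2 /Edisc -bmeas_RintegralZl//; apply: bmeas_le_Rintegral => //.
    by apply: bmeasM => //; exact: bmeas_cst.
  by move=> x _; exact: diag_sum_ge.
have hO : Edisc2 off_sum <= 105%:R / 200%:R * (Edisc2 majorant + Edisc2 (fun p =>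
  majorant (p.2, p.1))).
  rewrite /Edisc2 -bmeas_RintegralD// -bmeas_RintegralZl//; last exact: bmeasD.
  apply: bmeas_le_Rintegral => //.
    by apply: bmeasM; [exact: bmeas_cst|exact: bmeasD].
  by move=> p _; exact: off_sum_le.
have -> : \sum_(k < N) ((Ediag (fun x => re_part k x * re_part k x) - Eksqr (re_part k)
  (re_part k)) +
                 (Ediag (fun x => im_part k x * im_part k x) - Eksqr (im_part k) (im_part
                   k))) =
   Edisc (fun x => diag_sum x * kdiag x) - Edisc2 off_sum.
  by rewrite -D -O -sumrB; apply: eq_bigr => k _; ring.
have := Edisc_sqr_ge1 hw; rewrite -/Eh2; have := majorant_bound; have := majorant_swap_bound.
move: (Edisc2 majorant) (Edisc2 _) (Edisc2 off_sum) (Edisc _) Eh2 hO hD => a b o e hh; lra.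
Qed.

End SpectralBound.

(** * Moebius maps and the supremum over the unit ball *)

Section Mobius.
Context {R : realType}.
Local Notation C := R[i].
Local Notation normc := (@Normc.normc R).
Local Notation Re := (@complex.Re R).
Local Notation Im := (@complex.Im R).

Lemma measurable_complexM d (T : measurableType d) (f g : T -> C) :
  measurable_fun setT f -> measurable_fun setT g -> measurable_fun setT (fun x => f x * g x).
Proof.
move=> mf mg.
have mRf := measurableT_comp (@measurable_Re R) mf; have mIf := measurableT_comp
  (@measurable_Im R) mf.
have mRg := measurableT_comp (@measurable_Re R) mg; have mIg := measurableT_comp
  (@measurable_Im R) mg.
apply: measurable_complexP.
  rewrite (_ : _ \o _ = fun x => Re (f x) * Re (g x) - Im (f x) * Im (g x)).
    by apply: measurable_funB; exact: measurable_funM.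
  by apply/funext => x; rewrite /= ReM.
rewrite (_ : _ \o _ = fun x => Re (f x) * Im (g x) + Im (f x) * Re (g x)).
  by apply: measurable_funD; exact: measurable_funM.
by apply/funext => x; rewrite /= ImM.
Qed.

Lemma measurable_complexB d (T : measurableType d) (f g : T -> C) :
  measurable_fun setT f -> measurable_fun setT g -> measurable_fun setT (fun x => f x - g x).
Proof.
move=> mf mg.
have mRf := measurableT_comp (@measurable_Re R) mf; have mIf := measurableT_comp
  (@measurable_Im R) mf.
have mRg := measurableT_comp (@measurable_Re R) mg; have mIg := measurableT_comp
  (@measurable_Im R) mg.
apply: measurable_complexP.
  rewrite (_ : _ \o _ = fun x => Re (f x) - Re (g x)); first exact: measurable_funB.
  by apply/funext => x; rewrite /= ReD ReN.
rewrite (_ : _ \o _ = fun x => Im (f x) - Im (g x)); first exact: measurable_funB.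
by apply/funext => x; rewrite /= ImD ImN.
Qed.

Lemma measurable_complexV d (T : measurableType d) (f : T -> C) :
  measurable_fun setT f -> measurable_fun setT (fun x => (f x)^-1).
Proof.
move=> mf.
have mRf := measurableT_comp (@measurable_Re R) mf; have mIf := measurableT_comp
  (@measurable_Im R) mf.
have mV : measurable_fun setT (fun x => (Re (f x) ^+ 2 + Im (f x) ^+ 2)^-1).
  apply: ge0_measurable_funV => [x|]; first by rewrite addr_ge0 ?sqr_ge0.
  by apply: measurable_funD; apply: measurable_funX.
apply: measurable_complexP.
  rewrite (_ : _ \o _ = fun x => Re (f x) * (Re (f x) ^+ 2 + Im (f x) ^+ 2)^-1).
    exact: measurable_funM.
  by apply/funext => x /=; case: (f x).
rewrite (_ : _ \o _ = fun x => - (Im (f x) * (Re (f x) ^+ 2 + Im (f x) ^+ 2)^-1)).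
  by apply: measurableT_comp => //; exact: measurable_funM.
by apply/funext => x /=; case: (f x).
Qed.

Lemma measurable_mobius (z : C) : measurable_fun setT (mobius z).
Proof.
apply: measurable_complexM; first by apply: measurable_complexB;
  [exact: measurable_id|exact: measurable_cst].
apply: measurable_complexV; apply: measurable_complexB; first exact: measurable_cst.
by apply: measurable_complexM; [exact: measurable_cst|exact: measurable_id].
Qed.

(** From [normc (1 - conjc z * x) ^+ 2 - normc (x - z) ^+ 2 =
    (1 - normc z ^+ 2) * (1 - normc x ^+ 2)]: a Moebius map keeps the points of the
    disc near its boundary near the boundary. *)
Lemma mobius_bound (z : C) (s : R) : disc R z -> 0 <= s -> s < 1 ->
  exists r : R, [/\ 0 <= r, r < 1 &
    forall x, disc R x -> normc (mobius z x) <= s -> normc x <= r].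
Proof.
move=> /discE z1 s0 s1; have z0 := normc_ge0 z.
pose e := (1 - s ^+ 2) * (1 - normc z) ^+ 2.
have s21 : 0 < 1 - s ^+ 2 by rewrite subr_gt0 exprn_ilt1.
have e0 : 0 < e by rewrite mulr_gt0// exprn_gt0// subr_gt0.
have e1 : e <= 1.
  rewrite -[leRHS]mul1r ler_pM ?(ltW s21) ?sqr_ge0//.
    by rewrite lerBlDr lerDl sqr_ge0.
  by rewrite exprn_ile1 ?subr_ge0 ?(ltW z1)// lerBlDr lerDl.
exists (Num.sqrt (1 - e)); split; first exact: sqrtr_ge0.
  by rewrite -[ltRHS]sqrtr1 ltr_sqrt//; lra.
move=> x /discE x1 hx; have x0 := normc_ge0 x.
have hd : 1 - normc z <= normc (1 - conjc z * x).
  apply: one_sub_ge; rewrite Normc.normcM normc_conj -[leRHS]mulr1.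
  by rewrite ler_pM ?normc_ge0 ?(ltW x1).
have d0 : 0 < normc (1 - conjc z * x) by apply: lt_le_trans hd; rewrite subr_gt0.
have hm : normc (x - z) ^+ 2 <= s ^+ 2 * normc (1 - conjc z * x) ^+ 2.
  rewrite -exprMn lerXn2r ?nnegrE ?normc_ge0 ?mulr_ge0 ?(ltW d0)//.
  by move: hx; rewrite /mobius Normc.normcM Normc.normcV ler_pdivrMr.
have key : normc (1 - conjc z * x) ^+ 2 - normc (x - z) ^+ 2 =
    (1 - normc z ^+ 2) * (1 - normc x ^+ 2).
  by rewrite !sqr_normcE; case: x z {x0 x1 hx hd d0 hm z1 z0 e e0 e1} => a b [c d] /=; ring.
have x21 : 0 <= 1 - normc x ^+ 2 by rewrite subr_ge0 exprn_ile1 ?(ltW x1).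
have hd2 : (1 - normc z) ^+ 2 <= normc (1 - conjc z * x) ^+ 2.
  by rewrite lerXn2r ?nnegrE ?(ltW d0) ?subr_ge0 ?(ltW z1).
have h1 : e <= (1 - s ^+ 2) * normc (1 - conjc z * x) ^+ 2 by rewrite ler_wpM2l ?(ltW s21).
have h2 : (1 - normc z ^+ 2) * (1 - normc x ^+ 2) <= 1 - normc x ^+ 2.
  by rewrite ler_piMl// lerBlDr lerDl sqr_ge0.
have : normc x ^+ 2 <= 1 - e.
  by move: h1 h2 hm key; move: (normc (1 - _) ^+ 2) (normc (x - z) ^+ 2) => a b; lra.
by move=> h; rewrite -(@ler_pXn2r _ 2) ?nnegrE ?sqrtr_ge0// sqr_sqrtr// subr_ge0.
Qed.

End Mobius.

Section NonMeasurableIntegral.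
Context d (T : measurableType d) (R : realType) (mu : {measure set T -> \bar R}).

(** The integral of a nonnegative function is a supremum over the simple functions
    below it, hence monotone even at a function whose measurability is unclear, such
    as the supremum of the errors over the unit ball. *)
Lemma integral_ge_measurable (g F : T -> \bar R) : (forall x, 0 <= g x)%E ->
  (forall x, g x <= F x)%E -> (\int[mu]_x g x <= \int[mu]_x F x)%E.
Proof.
move=> g0 gF; have F0 x : (0 <= F x)%E := le_trans (g0 x) (gF x).
rewrite !ge0_integralTE//; apply: ereal_sup_le => _ [h hg <-].
by exists h => //= x; apply: le_trans (gF x).
Qed.

End NonMeasurableIntegral.

Section Supremum.
Context {R : realType}.
Local Notation C := R[i].
Local Notation normc := (@Normc.normc R).
Local Notation Re := (@complex.Re R).
Local Notation Im := (@complex.Im R).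

Lemma unit_ball_poly N (c : 'I_N -> C) : \sum_(k < N) normc (c k) ^+ 2 <= 1 ->
  let f := fun x => \sum_(k < N) c k * onb k x in
  bergman_space f /\ bergman_norm f <= 1.
Proof.
move=> hc f.
pose b (k : 'I_N) : C := c k * (Num.sqrt k.+1%:R)%:C.
have fE : f = fun x => \sum_(k < N) b k * x ^+ k.
  by apply/funext => x; apply: eq_bigr => k _; rewrite /onb /b mulrA.
have L2 : L2norm_sqr f = (\sum_(k < N) normc (c k) ^+ 2)%:E.
  rewrite fE /L2norm_sqr bmeas_RintegralE; [|exact: measurable_disc|exact:
    area_disc_fin|exact: bmeas_normc_sqr (cbmeas_poly b)].
  rewrite parseval0; congr EFin; apply: eq_bigr => k _.
  rewrite /b Normc.normcM normc_real ?sqrtr_ge0// exprMn sqr_sqrtr ?ler0n//.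
  by rewrite mulfK// pnatr_eq0.
split; first by split; [rewrite fE; exact: holomorphic_poly|rewrite L2 ltry].
by rewrite /bergman_norm L2 /= -[leRHS]sqrtr1 ler_sqrt.
Qed.

Lemma ReMn (x : C) n : Re (x *+ n) = Re x *+ n.
Proof. by elim: n => [|n ih] //; rewrite !mulrS ReD ih. Qed.

Lemma ImMn (x : C) n : Im (x *+ n) = Im x *+ n.
Proof. by elim: n => [|n ih] //; rewrite !mulrS ImD ih. Qed.

Lemma Im_mulrC (z : C) (r : R) : Im (z * r%:C) = Im z * r.
Proof. by rewrite ImM /= mulr0 add0r. Qed.

Section LinearStatistic.
Variables (Rf : C -> R) (z : C) (r : R) (r1 : r < 1).

(** Cut off to the disc, where alone configurations have points: outside of it lies
    the pole of the Moebius map, which division by 0 sends to 0, back into the disc. *)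
Definition transported_weight (x : C) : R := \1_(disc R) x * Rf (mobius z x).
Local Notation rho := transported_weight.

Hypothesis srho : supported r rho.

Lemma g_statE X : g_stat Rf z X = conf_sum X rho.
Proof.
apply: eq_fsbigr => x xD; rewrite /rho indicE (mem_set (set_mem xD)) mul1r//.
Qed.

Lemma g_stat_funE (f : C -> C) X :
  g_stat_fun Rf z f X = \sum_(x <- pts r X) ((rho x)%:C * f x) *+ X x.
Proof.
rewrite -(conf_sum_pts r1).
  apply: eq_fsbigr => x xD; rewrite /rho indicE (mem_set (set_mem xD)) mul1r//.
by move=> x rx; rewrite srho// mul0r.
Qed.

Lemma g_stat_fun_sum N (c : 'I_N -> C) (e : nat -> C -> C) X :
  g_stat_fun Rf z (fun x => \sum_(k < N) c k * e k x) X =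
  \sum_(k < N) c k * g_stat_fun Rf z (e k) X.
Proof.
rewrite g_stat_funE; under [RHS]eq_bigr do rewrite g_stat_funE big_distrr /=.
rewrite exchange_big /=; apply: eq_bigr => x _.
rewrite big_distrr /= -sumrMnl; apply: eq_bigr => k _.
by rewrite mulrCA mulrnAr.
Qed.

Definition recon_error (g : R) (X : configuration R) (f : C -> C) : C :=
  g_stat_fun Rf z f X / g%:C - f z.

Lemma recon_error_sum g N (c : 'I_N -> C) (e : nat -> C -> C) X :
  recon_error g X (fun x => \sum_(k < N) c k * e k x) =
  \sum_(k < N) c k * recon_error g X (e k).
Proof.
rewrite /recon_error g_stat_fun_sum big_distrl /= -sumrB.
by apply: eq_bigr => k _; rewrite mulrBr mulrA.
Qed.

(** Duality in a finite-dimensional subspace: the unit vector whose coefficients are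
    proportional to the conjugates of the errors on the basis attains the Euclidean
    norm of these errors. *)
Lemma sup_recon_error_ge g N X :
  ((\sum_(k < N) normc (recon_error g X (onb k)) ^+ 2)%:E <=
   ereal_sup [set (normc (recon_error g X f) ^+ 2)%:E
             | f in [set f : C -> C | bergman_space f /\ (bergman_norm f <= 1)%R]])%E.
Proof.
pose l (k : nat) := recon_error g X (onb k).
pose s := \sum_(k < N) normc (l k) ^+ 2.
have s0 : 0 <= s by apply: sumr_ge0 => k _; exact: sqr_ge0.
pose t := Num.sqrt s.
have t0 : 0 <= t by exact: sqrtr_ge0.
have tt : t * t = s by rewrite -expr2 sqr_sqrtr.
(* When t = 0 the convention 0^-1 = 0 makes this the zero vector, as it should. *)
pose c (k : 'I_N) : C := conjc (l k) * (t^-1)%:C.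
have hc : \sum_(k < N) normc (c k) ^+ 2 <= 1.
  have -> : \sum_(k < N) normc (c k) ^+ 2 = s * t^-1 ^+ 2.
    rewrite big_distrl /=; apply: eq_bigr => k _.
    by rewrite /c Normc.normcM normc_conj normc_real ?invr_ge0// exprMn.
  have [->|t1] := eqVneq t 0; first by rewrite invr0 expr0n /= mulr0.
  by rewrite -tt -expr2 -exprMn divff ?expr1n.
apply: ereal_sup_ubound; exists (fun x => \sum_(k < N) c k * onb k x).
  exact: unit_ball_poly hc.
congr EFin; rewrite recon_error_sum.
have -> : \sum_(k < N) c k * recon_error g X (onb k) = t%:C.
  transitivity ((s * t^-1)%:C).
    rewrite /s rmorphM /= rmorph_sum /= big_distrl /=; apply: eq_bigr => k _.
    by rewrite -mulc_conj /c -/(l k) mulrAC [conjc _ * _]mulrC.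
  congr (_%:C); rewrite -tt.
  by have [->|t1] := eqVneq t 0; [rewrite !mul0r|rewrite mulfK].
by rewrite normc_real// expr2.
Qed.

Definition weight_density (g : R) (x : C) : R := rho x / g.

Lemma Re_recon_error g k X :
  Re (recon_error g X (onb k)) = conf_sum X (re_part (weight_density g) k) - Re (onb k z).
Proof.
have sw : supported r (re_part (weight_density g) k).
  by move=> x rx; rewrite /re_part /weight_density srho// !mul0r.
rewrite /recon_error ReD ReN g_stat_funE (conf_sum_pts r1 _ sw); congr (_ - _).
rewrite -fmorphV Re_mulrC Re_sum big_distrl /=; apply: eq_bigr => x _.
rewrite ReMn mulrnAl; congr (_ *+ _).
by rewrite [_%:C * _]mulrC Re_mulrC /re_part /weight_density [_ * rho x]mulrC mulrAC.
Qed.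

Lemma Im_recon_error g k X :
  Im (recon_error g X (onb k)) = conf_sum X (im_part (weight_density g) k) - Im (onb k z).
Proof.
have sw : supported r (im_part (weight_density g) k).
  by move=> x rx; rewrite /im_part /weight_density srho// !mul0r.
rewrite /recon_error ImD ImN g_stat_funE (conf_sum_pts r1 _ sw); congr (_ - _).
rewrite -fmorphV Im_mulrC Im_sum big_distrl /=; apply: eq_bigr => x _.
rewrite ImMn mulrnAl; congr (_ *+ _).
by rewrite [_%:C * _]mulrC Im_mulrC /im_part /weight_density [_ * rho x]mulrC mulrAC.
Qed.

End LinearStatistic.

End Supremum.

(** * The lower bound for every weight *)

Section Assembly.
Context {R : realType}.
Local Notation C := R[i].
Local Notation normc := (@Normc.normc R).

Lemma weight_supported (Rf : C -> R) (z : C) : disc R z -> admissible_weight Rf ->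
  exists r : R, [/\ 0 <= r, r < 1 & smeas r (transported_weight Rf z)].
Proof.
move=> hz adm; have [K [cK KD RK]] := weight_compact_support adm.
have [s [s0 s1 Ks]] := compact_sub_disc cK KD.
have [r [r0 r1 hr]] := mobius_bound hz s0 s1.
exists r; split => //; split.
  split.
    apply: measurable_funM; first by apply: measurable_indic; exact: measurable_disc.
    exact: measurableT_comp (weight_measurable adm) (measurable_mobius z).
  have [M hM] := weight_bounded adm; exists M => x _.
  have h0 := weight_ge0 adm (mobius z x).
  rewrite ger0_norm ?mulr_ge0 ?indicE ?ler0n//.
  by apply: le_trans (hM (mobius z x)); rewrite ler_piMl//; case: (x \in _);
    rewrite ?lexx ?ler01.
move=> x rx; rewrite /transported_weight indicE.
have [/set_mem Dx|_] := boolP (x \in disc R); last by rewrite mul0r.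
rewrite mul1r; apply/eqP; apply: contraTT rx => Rx; rewrite -leNgt.
by apply: hr => //; apply: Ks; apply: RK.
Qed.

Variables (P : probability (Conf R) R) (hP : determinantal_process P bergman_kernel).

Lemma g_meanE (Rf : C -> R) (z : C) (r : R) : r < 1 -> smeas r (transported_weight Rf z) ->
  (forall x, 0 <= Rf x) -> g_mean P Rf z = Ediag (transported_weight Rf z).
Proof.
move=> r1 bw w0; rewrite /g_mean unlock.
under eq_integral do rewrite g_statE.
by rewrite (mean_stat hP r1 bw)// => x; rewrite mulr_ge0// indicE ler0n.
Qed.

Lemma expected_error_ge (Rf : C -> R) (z : C) : disc R z -> admissible_weight Rf ->
  ((39%:R / 100%:R)%:E <=
   \int[P]_X ereal_sup
     [set (normc (recon_error Rf z (g_mean P Rf z) X f) ^+ 2)%:E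
     | f in [set f : C -> C | bergman_space f /\ (bergman_norm f <= 1)%R]])%E.
Proof.
move=> hz adm; have w0 := weight_ge0 adm.
have [r [r0 r1 bw]] := weight_supported hz adm.
have srho := bw.2.
have gE := g_meanE r1 bw w0.
have [g0|g0] := eqVneq (g_mean P Rf z) 0.
  (* Division by 0 returns 0, so the error of f is - f z, which has modulus 1 for f = 1. *)
  apply: (@le_trans _ _ (\int[P]_X (cst 1 X))%E).
    rewrite integral_cst// mul1e.
    apply: (@le_trans _ _ 1%E); last first.
      by rewrite le_eqVlt; apply/orP; left; apply/eqP/esym; exact: (probability_setT P).
    by rewrite lee_fin; lra.
  apply: integral_ge_measurable => X; first by rewrite lee01.
  apply: le_trans (sup_recon_error_ge r1 srho _ 1 X).
  rewrite lee_fin big_ord_recl big_ord0 addr0 /recon_error g0.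
  rewrite invr0 mulr0 sub0r normcN /onb expr0 mulr1 sqrtr1 Normc.normc1 expr1n.
  exact: lexx.
have [N hN] := small_tail r0 r1.
pose g := g_mean P Rf z; pose w := weight_density Rf z g.
have g_ge0 : 0 <= g.
  rewrite /g gE; apply: Rintegral_ge0 => x _.
  by rewrite mulr_ge0 ?invr_ge0 ?sqr_ge0// mulr_ge0// indicE ler0n.
have bwd : smeas r w.
  by apply: (smeas_mul bw); exact: bmeas_cst.
have w_ge0 x : 0 <= w x by rewrite divr_ge0// mulr_ge0// indicE ler0n.
have w1 : Ediag w = 1.
  rewrite /Ediag /Edisc.
  transitivity (\int[@disc_area R]_x (g^-1 * (transported_weight Rf z x * kdiag x))).
    by apply: eq_Rintegral => x _; rewrite /w /weight_density; ring.
  have bk := smeas_kdiag r1 bw.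
  rewrite bmeas_RintegralZl; [|exact: measurableT|exact: disc_area_fin|exact: bk].
  by rewrite -/(Edisc _) -/(Ediag _) -gE mulVf.
pose U k (X : Conf R) := conf_sum X (re_part w k) - complex.Re (onb k z).
pose V k (X : Conf R) := conf_sum X (im_part w k) - complex.Im (onb k z).
have vU k := second_moment_ge hP r1 (complex.Re (onb k z)) (smeas_re_part r1 bwd k).
have vV k := second_moment_ge hP r1 (complex.Im (onb k z)) (smeas_im_part r1 bwd k).
have mU k : measurable_fun setT (fun X => ((U k X) ^+ 2)%:E).
  apply/measurable_EFinP; apply: measurable_funX; apply: measurable_funB.
    exact: (vU k).1.
  exact: measurable_cst.
have mV k : measurable_fun setT (fun X => ((V k X) ^+ 2)%:E).
  apply/measurable_EFinP; apply: measurable_funX; apply: measurable_funB.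
    exact: (vV k).1.
  exact: measurable_cst.
have errE X : (\sum_(k < N) normc (recon_error Rf z g X (onb k)) ^+ 2)%:E =
    (\sum_(k < N) ((U k X ^+ 2)%:E + (V k X ^+ 2)%:E))%E.
  rewrite -sumEFin; apply: eq_bigr => k _.
  by rewrite sqr_normcE (Re_recon_error r1 srho) (Im_recon_error r1 srho) EFinD.
apply: (@le_trans _ _ (\int[P]_X (\sum_(k < N) ((U k X ^+ 2)%:E + (V k X ^+ 2)%:E)))%E);
  last first.
  apply: integral_ge_measurable => X.
    by rewrite -errE lee_fin sumr_ge0// => k _; exact: sqr_ge0.
  by rewrite -errE; exact: (sup_recon_error_ge r1 srho).
have add_ge0 k X : (0 <= (U k X ^+ 2)%:E + (V k X ^+ 2)%:E)%E.
  by rewrite adde_ge0// lee_fin sqr_ge0.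
rewrite ge0_integral_sum//; last by move=> k; exact: emeasurable_funD.
apply: (@le_trans _ _ (\sum_(k < N) ((Ediag (fun x => re_part w k x * re_part w k
  x)%R - Eksqr (re_part w k) (re_part w k)) +
                 (Ediag (fun x => im_part w k x * im_part w k x)%R - Eksqr (im_part w k)
                   (im_part w k)))%:E)%E).
  by rewrite sumEFin lee_fin; exact: (spectral_bound r0 r1 hN bwd w_ge0 w1).
apply: lee_sum => k _; rewrite ge0_integralD//; last 2 first.
- by move=> X _; rewrite lee_fin sqr_ge0.
- by move=> X _; rewrite lee_fin sqr_ge0.
by rewrite EFinD leeD//; [exact: (vU k).2|exact: (vV k).2].
Qed.

End Assembly.

Theorem theorem1p12 (R : realType) (P : probability (Conf R) R)
    (hP : determinantal_process P bergman_kernel) (z : R[i]) (hz : disc R z) :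
  (ereal_inf
     [set (\int[P]_X ereal_sup
             [set (Normc.normc (g_stat_fun Rf z f X / (g_mean P Rf z)%:C - f z)
                     ^+ 2)%:E
             | f in [set f : R[i] -> R[i] |
                       bergman_space f /\ (bergman_norm f <= 1)%R]])%E
     | Rf in [set Rf : R[i] -> R | admissible_weight Rf]]
   >= (1 / 128%:R)%:E)%E.
Proof.
apply: le_ereal_inf_tmp => _ [Rf adm <-].
apply: le_trans (expected_error_ge hP hz adm).
by rewrite lee_fin; lra.
Qed.
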